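(* Let $N\ge2$, $0<s<1$ and $p>\frac{N}{N-2s}$. Assume that $u\in C^{2}(\mathbb{R}^{N})\cap\mathcal{L}_{s}$ is a positive (classical, pointwise) solution of $$-\mathcal{I}u=u^{p}\quad\text{in }\mathbb{R}^{N}$$ and that $$u(x)=o\left(|x|^{-\frac{2s}{p-1}}\right)\quad\text{as }|x|\to+\infty.$$ Then there exists $\widetilde{x}\in\mathbb{R}^{N}$ such that: (1) for every $i\in\{1,\dots,N\}$, $u$ is symmetric with respect to the hyperplane $$P_{e_{i},\widetilde{x}}=\{x\in\mathbb{R}^{N}:x_{i}=\widetilde{x}_{i}\}$$ and $u$ decreases in the $e_{i}$ direction; (2) $u$ is not radially symmetric about $\widetilde{x}$.
   Context: Let $e_1,\dots,e_N$ be the standard orthonormal basis of $\mathbb{R}^N$. The operator is $\mathcal{I}u=\sum_{i=1}^{N}\mathcal{I}_iu$, where $$\mathcal{I}_{i}u(x)=\frac{C_{s}}{2}\int_{\mathbb{R}}\frac{u(x+te_{i})+u(x-te_{i})-2u(x)}{|t|^{1+2s}}\,dt,\qquad C_{s}=\left(\int_{\mathbb{R}}\frac{1-\cos x}{|x|^{1+2s}}\,dx\right)^{-1}.$$ The space $\mathcal{L}_s$ is $$\mathcal{L}_{s}=\left\{u\in L^{1}_{loc}(\mathbb{R}^{N}):\limsup_{|x|\to+\infty}\frac{|u(x)|}{|x|^{2s-\delta_{1}}}<+\infty\text{ for some }\delta_{1}\in(0,2s]\right\}.$$ ''$u$ is symmetric with respect to a hyperplane'' means that $u$ is invariant under the orthogonal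 reflection across it. ''$u$ decreases in the $e_i$ direction'' means decreasing away from the symmetry hyperplane: for every $z\in P_{e_i,\widetilde{x}}$ and all $0\le t_1<t_2$, $u(z+t_2e_i)<u(z+t_1e_i)$. *)

(* Defs.v *)
From HB Require Import structures.
From mathcomp Require Import all_boot all_order all_algebra.
From mathcomp Require Import all_classical all_reals all_analysis.

Set Implicit Arguments.
Unset Strict Implicit.
Unset Printing Implicit Defensive.
Import Order.TTheory GRing.Theory Num.Theory.
Import numFieldNormedType.Exports.

Local Open Scope classical_set_scope.
Local Open Scope ring_scope.

(* The library's norm on 'rV[R]_N is the sup norm; |x| in the statement is the
   Euclidean one. *)
Definition enorm (R : realType) (N : nat) (x : 'rV[R]_N) : R :=
  Num.sqrt (\sum_(i < N) x 0 i ^+ 2).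

Definition ebasis (R : realType) (N : nat) (i : 'I_N) : 'rV[R]_N :=
  delta_mx 0 i.

(* The filter of the limits "as |x| -> +oo". *)
Definition at_infinity (R : realType) (N : nat) : set_system 'rV[R]_N :=
  [set A | exists M : R, forall x, M < enorm x -> A x].
Arguments at_infinity {R N}.

Global Instance at_infinity_filter (R : realType) (N : nat) :
  Filter (@at_infinity R N).
Proof.
split; first by exists 0.
- move=> A B [M HM] [M' HM']; exists (Num.max M M') => x.
  by rewrite gt_max => /andP[xM xM']; split; [exact: HM|exact: HM'].
- by move=> A B AB [M HM]; exists M => x /HM /AB.
Qed.

Canonical at_infinity_filterType (R : realType) (N : nat) :=
  FilterType (@at_infinity R N) (at_infinity_filter R N).

(* All partial derivatives of order at most k exist and are continuous. *)
Fixpoint Ck (R : realType) (N : nat) (k : nat) (f : 'rV[R]_N -> R) : Prop :=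
  continuous f /\
  if k is k'.+1 then
    forall i : 'I_N, (forall x, derivable f x (ebasis R i)) /\
                     Ck k' (fun x => 'D_(ebasis R i) f x)
  else True.

(* N-dimensional Lebesgue measure, on N-tuples with the product sigma-algebra:
   the iterated product of the one-dimensional Lebesgue measure. *)
Section lebesgue_step.
Context (R : realType) (n : nat).
Local Notation T := (measurableTypeR R).
Variable mu : {sigma_finite_measure set (n.-tuple T) -> \bar R}.

Definition tcons (p : T * n.-tuple T) : n.+1.-tuple T := [tuple of p.1 :: p.2].

Lemma measurable_tcons : measurable_fun setT tcons.
Proof. exact: measurable_cons. Qed.

Definition lebesgue_step : set (n.+1.-tuple T) -> \bar R :=
  pushforward (@lebesgue_measure R \x mu)%E tcons.

Let lebesgue_step0 : lebesgue_step set0 = 0%E.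
Proof. by rewrite /lebesgue_step /pushforward preimage_set0 measure0. Qed.

Let lebesgue_step_ge0 A : (0 <= lebesgue_step A)%E.
Proof. by rewrite /lebesgue_step /pushforward. Qed.

Let lebesgue_step_sigma_additive : semi_sigma_additive lebesgue_step.
Proof.
move=> F mF tF mUF; rewrite /lebesgue_step /pushforward preimage_bigcup.
apply: measure_semi_sigma_additive.
- by move=> n'; rewrite -[X in measurable X]setTI; exact: measurable_tcons.
- apply/trivIsetP => /= i j _ _ ij; rewrite -preimage_setI.
  by move/trivIsetP : tF => /(_ _ _ _ _ ij) ->//; rewrite preimage_set0.
- by rewrite -preimage_bigcup -[X in measurable X]setTI; exact: measurable_tcons.
Qed.

HB.instance Definition _ := isMeasure.Build _ _ _ lebesgue_step
  lebesgue_step0 lebesgue_step_ge0 lebesgue_step_sigma_additive.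

Lemma lebesgue_step_sigma_finite : sigma_finite setT lebesgue_step.
Proof.
have /sigma_finiteP[F [FT ndF Foo]] := sigma_finiteT (@lebesgue_measure R).
have /sigma_finiteP[G [GT ndG Goo]] := sigma_finiteT mu.
pose g (t : n.+1.-tuple T) : T * n.-tuple T := (thead t, [tuple of behead t]).
have mg : measurable_fun setT g.
  apply: measurable_fun_pair; first exact: measurable_tnth.
  exact: measurable_behead.
have gK p : g (tcons p) = p.
  by case: p => a t; rewrite /g /tcons/=; congr pair; apply: val_inj.
exists (fun k => g @^-1` (F k `*` G k)).
  apply/seteqP; split => // t _.
  have [k _ Fk] : (\bigcup_k F k) (thead t) by rewrite -FT.
  have [l _ Gl] : (\bigcup_k G k) [tuple of behead t] by rewrite -GT.
  exists (maxn k l) => //; split => /=.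
    by move: Fk; exact/subsetPset/ndF/leq_maxl.
  by move: Gl; exact/subsetPset/ndG/leq_maxr.
move=> k; have [mF Fk] := Foo k; have [mG Gk] := Goo k; split.
  by rewrite -[X in measurable X]setTI; apply: mg => //; exact: measurableX.
rewrite /lebesgue_step /pushforward (_ : tcons @^-1` _ = F k `*` G k).
  by rewrite product_measure1E// lte_mul_pinfty// ge0_fin_numE.
by apply/funext => x; rewrite /preimage /mkset gK.
Qed.

HB.instance Definition _ :=
  Measure_isSigmaFinite.Build _ _ _ lebesgue_step lebesgue_step_sigma_finite.

End lebesgue_step.

Fixpoint lebesgueN (R : realType) (N : nat) :
    {sigma_finite_measure set (N.-tuple (measurableTypeR R)) -> \bar R} :=
  if N is n.+1 then lebesgue_step (lebesgueN R n)
  else \d_([tuple] : 0.-tuple (measurableTypeR R)).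

Definition row_of_tuple (R : realType) (N : nat)
    (t : N.-tuple (measurableTypeR R)) : 'rV[R]_N :=
  \row_(i < N) tnth t i.

(* L^1_loc(R^N); [locally_integrable] of the library is for functions on R. *)
Definition L1loc (R : realType) (N : nat) (f : 'rV[R]_N -> R) : Prop :=
  measurable_fun setT (f \o @row_of_tuple R N) /\
  forall K : set 'rV[R]_N, compact K ->
    (\int[lebesgueN R N]_(t in @row_of_tuple R N @^-1` K)
       `|f (row_of_tuple t)|%:E < +oo)%E.

Definition Ls (R : realType) (N : nat) (s : R) (u : 'rV[R]_N -> R) : Prop :=
  L1loc u /\
  exists delta1 : R, 0 < delta1 <= 2 * s /\
    (limf_esup (fun x => (`|u x| / enorm x `^ (2 * s - delta1))%:E)
       at_infinity < +oo)%E.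

(* The one-dimensional integrals below are real-valued Lebesgue integrals. For
   0 < s < 1 the one in [Cs] converges absolutely, and so does the one in
   [frac_dir] whenever u is C^2 and in [Ls s]. *)
Definition Cs (R : realType) (s : R) : R :=
  (\int[@lebesgue_measure R]_x ((1 - cos x) / `|x| `^ (1 + 2 * s)))^-1.

Definition frac_dir (R : realType) (N : nat) (s : R) (i : 'I_N)
    (u : 'rV[R]_N -> R) (x : 'rV[R]_N) : R :=
  Cs s / 2 *
  \int[@lebesgue_measure R]_t
    ((u (x + t *: ebasis R i) + u (x - t *: ebasis R i) - 2 * u x)
       / `|t| `^ (1 + 2 * s)).

Definition frac_op (R : realType) (N : nat) (s : R)
    (u : 'rV[R]_N -> R) (x : 'rV[R]_N) : R :=
  \sum_(i < N) frac_dir s i u x.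

Definition hyperplane (R : realType) (N : nat) (i : 'I_N) (c : 'rV[R]_N) :
    set 'rV[R]_N :=
  [set x | x 0 i = c 0 i].

(* Orthogonal reflection across [hyperplane i c]. *)
Definition reflection (R : realType) (N : nat) (i : 'I_N) (c x : 'rV[R]_N) :
    'rV[R]_N :=
  x - (2 * (x 0 i - c 0 i)) *: ebasis R i.

Definition symmetric_about (R : realType) (N : nat) (i : 'I_N) (c : 'rV[R]_N)
    (u : 'rV[R]_N -> R) : Prop :=
  forall x, u (reflection i c x) = u x.

Definition decreasing_from (R : realType) (N : nat) (i : 'I_N) (c : 'rV[R]_N)
    (u : 'rV[R]_N -> R) : Prop :=
  forall z, hyperplane i c z -> forall t1 t2 : R, 0 <= t1 -> t1 < t2 ->
    u (z + t2 *: ebasis R i) < u (z + t1 *: ebasis R i).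

Definition radially_symmetric (R : realType) (N : nat) (c : 'rV[R]_N)
    (u : 'rV[R]_N -> R) : Prop :=
  exists g : R -> R, forall x, u x = g (enorm (x - c)).

(* Main.v *)
Require Import Defs.
From HB Require Import structures.
From mathcomp Require Import all_boot all_order all_algebra.
From mathcomp Require Import all_classical all_reals all_analysis.
From mathcomp Require Import measurable_realfun ring lra.
Import Order.TTheory GRing.Theory Num.Theory.
Import numFieldNormedType.Exports.
Local Open Scope classical_set_scope.
Local Open Scope ring_scope.

(** The operator is a sum of one-dimensional fractional Laplacians along the
coordinate lines, so the whole proof works on lines.

Symmetry and monotonicity come from moving the planes x_i = l. Let w be the
difference between the reflection of u and u. If w is negative somewhere in
the half space x_i < l, it has a negative minimum x there, because u vanishes
at infinity and is positive. On the lines through x parallel to the plane the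
minimum is global, so they contribute a nonnegative amount to the operator; on
the line across the plane the antisymmetry of w gives at least a constant times
|w x| d^(-2s), where d is the distance from x to the plane
([frac1_antisym_ge]). Since t^p has slope at most p u^(p-1) on the range of
interest, the equation yields a lower bound for d^(2s) u(x)^(p-1)
([negative_minimum_estimate]). Hence x is neither close to the plane, as u is
bounded, nor far from the origin, as the assumed decay says exactly that
u^(p-1) is o(|x|^(-2s)). So there is no negative minimum when l is close to
minus infinity, and the plane can be moved until the comparison breaks. It
stops at a plane of symmetry: a zero of a nonnegative w spreads along every
coordinate line through it, hence to the whole half space ([strong_maximum]),
and without a zero compactness lets the plane move a little further
([plane_exists]).

Now let u be radial about the centre, with profile g. Then u^p, and so the
operator, takes the same value at the points at distance r from the centre in
the directions e_0 and (e_0 + e_1) / sqrt 2. This is a linear condition on the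
dilate a |-> g (r a), for each r > 0, and it passes to superpositions of
dilates. The weight r^(-2) dr turns the dilates of g 0 - g into a multiple of
a |-> a, that is, of the cone x |-> |x|, and for the cone the two values are
different: this is an inequality between sums of distances in the plane
([diff2_id_lt]). The superposition and the singular integral cannot be
exchanged directly, because nothing bounds the second derivatives of u at
infinity; so the weight is cut off at the scales n and 1/n. The resulting
functions are superpositions of cones truncated near their vertex
([cutoff_cone]), whose second differences are bounded uniformly in the
truncation, and dominated convergence recovers the cone as n grows
([radial_profile_contradiction]). *)

Set Implicit Arguments.
Unset Strict Implicit.
Unset Printing Implicit Defensive.

(** * Integrals of real functions on the line *)

Section RealIntegrals.
Context {R : realType}.
Local Notation mu := (@lebesgue_measure R).
Local Notation intg f := (mu.-integrable setT (EFin \o f)).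
Implicit Types f g : R -> R.

Lemma integrable_measurable f : intg f -> measurable_fun setT f.
Proof. by move=> /(measurable_int mu)/measurable_EFinP. Qed.

Lemma integrable_le f g : measurable_fun setT f ->
  (forall x, `|f x| <= g x) -> intg g -> intg f.
Proof.
move=> mf fg; apply: le_integrable => //; first exact/measurable_EFinP.
by move=> x _ /=; rewrite lee_fin (le_trans (fg x))// ler_norm.
Qed.

Lemma integrableRD f g : intg f -> intg g -> intg (fun x => f x + g x).
Proof. exact: integrableD. Qed.

Lemma integrableRB f g : intg f -> intg g -> intg (fun x => f x - g x).
Proof. exact: integrableB. Qed.

Lemma integrableRZ (c : R) f : intg f -> intg (fun x => c * f x).
Proof. exact: integrableZl. Qed.

Lemma EFin_Rintegral f : intg f ->
  (\int[mu]_t f t)%:E = (\int[mu]_t (f t)%:E)%E.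
Proof. by move=> /(integrable_fin_num measurableT) fi; rewrite /Rintegral fineK. Qed.

(** Lebesgue measure is determined by its values on half-open intervals, which
    an affine map rescales by the absolute value of its slope. *)
Lemma ge0_integral_affine (h : R -> \bar R) (c r : R) : r != 0 ->
  measurable_fun setT h -> (forall x, 0 <= h x)%E ->
  (\int[mu]_t h t = `|r|%:E * \int[mu]_t h (c + r * t)%R)%E.
Proof.
move=> r0 mh h0.
have r0' : 0 < `|r| by rewrite normr_gt0.
pose phi (t : measurableTypeR R) : measurableTypeR R := c + r * t.
have mphi : measurable_fun setT phi.
  by apply: measurable_funD => //; exact: measurable_funM.
pose nu0 : {measure set (measurableTypeR R) -> \bar R} :=
  pushforward mu phi.
pose nu := nu0 mphi.
pose rn : {nonneg R} := NngNum (ltW r0').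
have muE A : measurable A -> mu A = mscale rn nu A.
  move=> mA; apply: lebesgue_measure_unique => // _ [[a b]] _ <-.
  transitivity (`|r|%:E * mu (phi @^-1` `]a, b]))%E; last by [].
  have [rp|rm] := ltP 0 r.
    have -> : phi @^-1` `]a, b] = `](a - c) / r, (b - c) / r]%classic.
      apply/seteqP; split => x /=; rewrite !in_itv/= ltr_pdivrMr// ler_pdivlMr//;
        rewrite ltrBlDl lerBrDl (mulrC x)//.
    rewrite !lebesgue_measure_itv/= !lte_fin ltr_pM2r ?invr_gt0// ltrD2r.
    case: ifPn => ab; last by rewrite mule0.
    by rewrite -!EFinD -EFinM gtr0_norm//; congr EFin; field.
  have {rm} rn0 : r < 0 by rewrite lt_neqAle r0.
  have -> : phi @^-1` `]a, b] = `[(b - c) / r, (a - c) / r[%classic.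
    apply/seteqP; split => x /=; rewrite !in_itv/= ltr_ndivlMr// ler_ndivrMr//;
      rewrite ltrBlDl lerBrDl (mulrC x)// andbC//.
  rewrite !lebesgue_measure_itv/= !lte_fin ltr_nM2r ?invr_lt0// ltrD2r.
  case: ifPn => ab; last by rewrite mule0.
  by rewrite -!EFinD -EFinM ltr0_norm//; congr EFin; field.
rewrite (eq_measure_integral (mscale rn nu)); last by move=> A mA _; exact: muE.
by rewrite ge0_integral_mscale//= ge0_integral_pushforward.
Qed.

Lemma integrable_affine f (c r : R) : r != 0 -> intg f ->
  intg (fun t => f (c + r * t)).
Proof.
move=> r0 /[dup] fi /integrableP[mf foo]; apply/integrableP; split.
  apply/measurable_EFinP; apply: (measurableT_comp (integrable_measurable fi)).
  by apply: measurable_funD => //; exact: measurable_funM.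
move: foo; rewrite (@ge0_integral_affine _ c r)//; last exact: measurableT_comp.
apply: contraPP => /negP; rewrite -leNgt leye_eq => /eqP /= ->.
by rewrite gt0_muley// lte_fin normr_gt0.
Qed.

Lemma Rintegral_affine f (c r : R) : r != 0 -> intg f ->
  \int[mu]_t f (c + r * t) = `|r|^-1 * \int[mu]_t f t.
Proof.
move=> r0 fi; have fri := integrable_affine c r0 fi.
have r0' : 0 < `|r| by rewrite normr_gt0.
have mf : measurable_fun setT (EFin \o f) by case/integrableP: fi.
have aux (h : R -> \bar R) : measurable_fun setT h -> (forall x, 0 <= h x)%E ->
   (\int[mu]_t h (c + r * t)%R = `|r|^-1%:E * \int[mu]_t h t)%E.
  move=> mh h0; rewrite [in RHS](@ge0_integral_affine _ c r)// muleA -EFinM mulVf ?mul1e//.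
  by rewrite gt_eqF.
apply: EFin_inj; rewrite EFinM !EFin_Rintegral//.
rewrite [LHS]integralE [in RHS]integralE muleBr//.
  congr (_ - _)%E.
    rewrite -(aux _ (measurable_funepos mf))//.
    by apply: eq_integral => x _; rewrite !funeposE.
  rewrite -(aux _ (measurable_funeneg mf))//.
  by apply: eq_integral => x _; rewrite !funenegE.
apply: fin_num_adde_defr; apply: (integrable_pos_fin_num (mu := mu)) => //.
Qed.

Lemma Rintegral_ge_itv f (a b c : R) : (forall x, 0 <= f x) -> intg f ->
  a < b -> 0 <= c -> (forall x, a <= x <= b -> c <= f x) ->
  c * (b - a) <= \int[mu]_t f t.
Proof.
move=> f0 fi ab c0 cf; pose B : set R := `[a, b]%classic.
rewrite -lee_fin EFin_Rintegral//.
have muB : mu B = (b - a)%:E.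
  by rewrite /B lebesgue_measure_itv/= lte_fin ab EFinB.
apply: (@le_trans _ _ (\int[mu]_(t in B) c%:E)%E).
  by rewrite integral_cst; [rewrite [X in (_ * X)%E](_ : _ = (b - a)%:E)|exact: measurable_itv].
have mEf D : measurable_fun D (EFin \o f).
  by apply/measurable_EFinP; apply: measurable_funTS; exact: integrable_measurable fi.
apply: (@le_trans _ _ (\int[mu]_(t in B) (f t)%:E)%E).
  apply: ge0_le_integral.
  - exact: measurable_itv.
  - by move=> x _; rewrite lee_fin.
  - exact: measurable_cst.
  - exact: mEf.
  - by move=> x; rewrite /B /= in_itv/= lee_fin; exact: cf.
apply: ge0_subset_integral => //.
- exact: measurable_itv.
- exact: mEf.
- by move=> x _; rewrite lee_fin.
Qed.

Lemma Rintegral_gt0 f (x0 c : R) : (forall x, 0 <= f x) -> intg f ->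
  0 < c -> (\forall x \near x0, c <= f x) -> 0 < \int[mu]_t f t.
Proof.
move=> f0 fi c0 /nbhs_ballP[e /= e0 He].
apply: (@lt_le_trans _ _ (c * (x0 + e / 2 - (x0 - e / 2)))).
  by rewrite mulr_gt0// (_ : _ - _ = e)//; field.
apply: Rintegral_ge_itv => //; [lra|exact: ltW|].
move=> x /andP[xl xr]; apply: He; rewrite /ball /= ltr_distlC.
by apply/andP; split; lra.
Qed.

Lemma le_Rint f g : intg f -> intg g -> (forall x, f x <= g x) ->
  \int[mu]_t f t <= \int[mu]_t g t.
Proof. by move=> fi gi fg; apply: le_Rintegral. Qed.

Lemma dominated_cvg_Rintegral (f_ : nat -> R -> R) f g :
  (forall n, measurable_fun setT (f_ n)) -> measurable_fun setT f ->
  (forall x, f_ ^~ x @ \oo --> f x) -> intg g ->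
  (forall n x, `|f_ n x| <= g x) ->
  intg f /\ (\int[mu]_t f_ n t @[n --> \oo] --> \int[mu]_t f t).
Proof.
move=> mf_ mf cf gi fg.
have [] := @dominated_convergence _ _ _ mu setT measurableT
  (fun n => EFin \o f_ n) (EFin \o f) (EFin \o g).
- by move=> n; apply/measurable_EFinP; exact: mf_.
- by apply/measurable_EFinP.
- apply: aeW => x _; apply/fine_cvgP; split; first exact: nearW.
  exact: cf.
- by [].
- by apply: aeW => x n _ /=; rewrite lee_fin.
move=> fi _ H; split=> //.
apply: fine_cvg; rewrite EFin_Rintegral//.
Qed.

(** A product dominating function makes absolute integrability a
    one-dimensional matter and makes every section integrable, so that the
    real-valued inner integrals are the true ones. *)
Lemma Rintegral_Fubini (F : R -> R -> R) (a b : R -> R) :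
  measurable_fun setT (fun z : R * R => F z.1 z.2) ->
  intg a -> intg b -> (forall x y, `|F x y| <= a x * b y) ->
  intg (fun x => \int[mu]_y F x y) /\
  \int[mu]_x \int[mu]_y F x y = \int[mu]_y \int[mu]_x F x y.
Proof.
move=> mF ai bi Fab.
have ma := integrable_measurable ai; have mb := integrable_measurable bi.
have mF1 x : measurable_fun setT (F x).
  exact: (measurableT_comp mF (measurable_pair1 x)).
have mF2 y : measurable_fun setT (F ^~ y).
  exact: (measurableT_comp mF (measurable_pair2 y)).
have Fi1 x : intg (F x).
  apply: (integrable_le (mF1 x) (Fab x)).
  exact: (integrableZl measurableT (a x) bi).
have Fi2 y : intg (F ^~ y).
  apply: (integrable_le (mF2 y) (g := fun x => a x * b y)) => //.
  exact: (integrableZr measurableT (b y) ai).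
have Fi : (mu \x mu)%E.-integrable setT (EFin \o (fun z : R * R => F z.1 z.2)).
  apply/integrable12ltyP; first by apply/measurable_EFinP.
  apply: (@le_lt_trans _ _ (\int[mu]_x (`|(a x)%:E| * \int[mu]_y `|(b y)%:E|))%E).
    apply: ge0_le_integral => //.
    - by move=> x _; apply: integral_ge0.
    - pose G (z : measurableTypeR R * measurableTypeR R) := `|(F z.1 z.2)%:E|%E.
      have mG : measurable_fun setT G.
        by apply: measurableT_comp => //; apply/measurable_EFinP.
      by have := measurable_fun_fubini_tonelli_F (m2 := mu) G mG
        (fun=> abse_ge0 _).
    - apply: emeasurable_funM => //.
      by apply: measurableT_comp => //; apply/measurable_EFinP.
    - move=> x _; rewrite -ge0_integralZl//; last first.
        by apply: measurableT_comp => //; apply/measurable_EFinP.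
      apply: ge0_le_integral => //.
      + apply: (@measurableT_comp _ _ _ _ _ _ abse) => //.
        by apply/measurable_EFinP; exact: mF1.
      + apply: emeasurable_funM => //.
        by apply: measurableT_comp => //; apply/measurable_EFinP.
      + by move=> y _; rewrite -abseM lee_fin (le_trans (Fab x y))// ler_norm.
  have /integrableP[_ bfin] := bi; have /integrableP[_ afin] := ai.
  rewrite ge0_integralZr//=.
  - apply: lte_mul_pinfty => //; first exact: integral_ge0.
    by rewrite ge0_fin_numE//; exact: integral_ge0.
  - by apply/measurable_EFinP; exact: (measurableT_comp _ ma).
  - exact: integral_ge0.
split.
  have := integrable_fubini_F Fi; congr (is_true (integrable _ _ _)).
  by apply/funext => x /=; rewrite EFin_Rintegral.
have := @Fubini _ _ _ _ _ mu mu _ Fi => /= H.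
rewrite /Rintegral; congr fine.
under eq_integral do rewrite EFin_Rintegral//.
rewrite H; apply: eq_integral => y _.
by rewrite EFin_Rintegral.
Qed.

End RealIntegrals.
Section PowerKernels.
Context {R : realType}.
Local Notation mu := (@lebesgue_measure R).
Local Notation intg f := (mu.-integrable setT (EFin \o f)).

Lemma integral_powR (q c d : R) : q + 1 != 0 -> 0 < c -> c < d ->
  (\int[mu]_(t in `[c, d]) (t `^ q)%:E =
   ((d `^ (q + 1) - c `^ (q + 1)) / (q + 1))%:E)%E.
Proof.
move=> q1 c0 cd.
pose F (t : R) := (q + 1)^-1 * t `^ (q + 1).
have dF (t : R) : 0 < t -> is_derive t 1 F (t `^ q).
  move=> t0; have := is_derive1_powR (q + 1) t0.
  move=> /(is_deriveZ (q + 1)^-1).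
  by rewrite addrK /GRing.scale/= mulrA mulVf// mul1r.
have cF (t : R) : 0 < t -> {for t, continuous F}.
  move=> t0; apply: differentiable_continuous; apply/derivable1_diffP.
  by have [] := dF _ t0.
rewrite (@continuous_FTC2 _ _ F)//.
- by rewrite -EFinB /F -mulrBr mulrC.
- apply: derivable_within_continuous => x; rewrite in_itv/= => /andP[cx _].
  by apply: derivable_powR; rewrite in_itv/= (lt_le_trans c0 cx).
- split.
  + move=> x; rewrite in_itv/= => /andP[cx _].
    by have [] := dF _ (lt_trans c0 cx).
  + by apply: cvg_at_right_filter; exact: cF.
  + by apply: cvg_at_left_filter; apply: cF; exact: lt_trans cd.
- move=> x; rewrite in_itv/= => /andP[cx _].
  by rewrite derive1E; have [_ ->] := dF _ (lt_trans c0 cx).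
Qed.

Lemma integral_le_limit (D : nat -> set R) (f : R -> R) (M : R) :
  nondecreasing_seq D -> (forall i, measurable (D i)) ->
  measurable_fun setT f -> (forall x, 0 <= f x) ->
  (forall i, \int[mu]_(t in D i) (f t)%:E <= M%:E)%E ->
  (\int[mu]_(t in \bigcup_i D i) (f t)%:E <= M%:E)%E.
Proof.
move=> ndD mD mf f0 fM.
have mEf i : measurable_fun (D i) (EFin \o f).
  by apply/measurable_EFinP; exact: measurable_funTS.
have H := @ge0_nondecreasing_set_cvg_integral _ (measurableTypeR R) R D (EFin \o f) mu ndD mD mEf.
have {H} := H (fun i x _ => f0 x).
move=> H; rewrite -(cvg_lim _ H)//.
by apply: lime_le; [exact: cvgP H|apply: nearW].
Qed.

(** The common dominating functions: the behaviour at the origin and the one at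
    infinity are prescribed independently. *)
Definition power_kernel (a b t : R) : R :=
  if `|t| <= 1 then `|t| `^ a else `|t| `^ (- b).

Lemma power_kernel_ge0 (a b t : R) : 0 <= power_kernel a b t.
Proof. by rewrite /power_kernel; case: ifP => _; exact: powR_ge0. Qed.

Lemma measurable_power_kernel (a b : R) : measurable_fun setT (power_kernel a b).
Proof.
have mn : measurable_fun setT (fun x : R => `|x|) by exact: normr_measurable.
apply: measurable_fun_ifT.
- by apply: measurable_fun_ler.
- exact: (measurableT_comp (measurable_powR a)).
- exact: (measurableT_comp (measurable_powR (- b))).
Qed.

Lemma integrable_power_kernel (a b : R) : -1 < a -> 1 < b -> intg (power_kernel a b).
Proof.
move=> a1 b1.
have mp := measurable_power_kernel a b.
pose f (t : R) := if 0 <= t then power_kernel a b t else 0.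
have mf : measurable_fun setT f.
  by apply: measurable_fun_ifT => //; exact: measurable_fun_ler.
have f0 t : 0 <= f t by rewrite /f; case: ifP => // _; exact: power_kernel_ge0.
suff fi : intg f.
  apply: (@integrable_le _ _ (fun t => f t + f (0 + (-1) * t))) => //.
    move=> t; rewrite ger0_norm ?power_kernel_ge0// add0r mulN1r.
    have [t0|t0] := leP 0 t; first by rewrite {1}/f t0 lerDl.
    by rewrite {2}/f oppr_ge0 (ltW t0) /power_kernel normrN lerDr.
  by apply: (integrableD measurableT) fi (integrable_affine _ _ fi); rewrite oppr_eq0 oner_eq0.
apply/integrableP; split; first by apply/measurable_EFinP.
suff : (\int[mu]_t (f t)%:E < +oo)%E.
  by congr (_ < _)%E; apply: eq_integral => t _ /=; rewrite ger0_norm.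
pose I1 := `]0, 1]%classic : set R; pose I2 := `]1, +oo[%classic : set R.
(* Exhaust ]0, 1] and ]1, +oo[ by compact intervals, where the fundamental
   theorem of calculus applies. *)
have i1 : (\int[mu]_(t in I1) (f t)%:E <= (1 / (a + 1))%:E)%E.
  have -> : I1 = \bigcup_i `[(i.+2%:R)^-1, 1]%classic.
    apply/seteqP; split => x; rewrite /I1/= ?in_itv/=.
      move=> /andP[x0 x1]; exists (Num.truncn x^-1) => //=.
      rewrite in_itv/= x1 andbT invf_ple ?posrE//.
      rewrite (le_trans (ltW (truncnS_gt _)))// ler_nat//.
    by move=> [i _] /=; rewrite !in_itv/= => /andP[ix ->]; rewrite andbT (lt_le_trans _ ix).
  apply: integral_le_limit => //.
    apply/nondecreasing_seqP => n; rewrite subsetEset; apply: subset_itvr.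
    by rewrite bnd_simp lef_pV2 ?posrE// ler_nat.
  move=> i; set c : R := i.+2%:R^-1.
  have ci : 0 < c by rewrite invr_gt0.
  pose Dc : set R := `[c, 1]%classic.
  have -> : (\int[mu]_(t in Dc) (f t)%:E = \int[mu]_(t in Dc) (t `^ a)%:E)%E.
    apply: eq_integral => t; rewrite inE/= /Dc/= in_itv/= => /andP[it t1].
    have t0 := lt_le_trans ci it.
    by rewrite /f /power_kernel (ltW t0) gtr0_norm// t1.
  rewrite /Dc integral_powR//; last 2 first.
    by lra.
    by rewrite invf_lt1// ltr1n.
  rewrite lee_fin ler_pM2r ?invr_gt0; last by lra.
  by rewrite powR1 gerBl powR_ge0.
have i2 : (\int[mu]_(t in I2) (f t)%:E <= (1 / (b - 1))%:E)%E.
  have -> : (\int[mu]_(t in I2) (f t)%:E = \int[mu]_(t in I2) ((t `^ (- b)))%:E)%E.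
    apply: eq_integral => t; rewrite inE/= /I2/= in_itv/= andbT => t1.
    rewrite /f /power_kernel (le_trans ler01 (ltW t1)) ger0_norm ?(le_trans ler01 (ltW t1))//.
    by rewrite leNgt t1.
  pose D2 (i : nat) : set R := `[1, i.+2%:R]%classic.
  have : (\int[mu]_(t in \bigcup_i D2 i) (t `^ (- b))%:E
      <= (1 / (b - 1))%:E)%E.
    apply: integral_le_limit => //.
    - apply/nondecreasing_seqP => n; rewrite subsetEset; apply: subset_itvl.
      by rewrite bnd_simp ler_nat.
    - by move=> i; exact: measurable_itv.
    - by move=> x; exact: powR_ge0.
    - move=> i; rewrite /D2 integral_powR ?ltr1n//; last by lra.
      rewrite lee_fin powR1 -mulrNN -invrN opprB opprD opprK.
      rewrite ler_pM2r ?invr_gt0; last by lra.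
      by rewrite gerBl powR_ge0.
  apply: le_trans; apply: ge0_subset_integral => //.
  - exact: measurable_itv.
  - by apply: bigcup_measurable => i _; exact: measurable_itv.
  - by apply/measurable_EFinP; apply: measurable_funTS; exact: measurable_powR.
  - by move=> x _; rewrite lee_fin powR_ge0.
  - move=> x /=; rewrite /I2/= in_itv/= andbT => x1; exists (Num.truncn x) => //=.
    by rewrite /D2/= in_itv/= (ltW x1) (le_trans (ltW (truncnS_gt _)))// ler_nat.
apply: (@le_lt_trans _ _ (\int[mu]_(t in I1) (f t)%:E + \int[mu]_(t in I2) (f t)%:E)%E); last first.
  by apply: lte_add_pinfty; [exact: (le_lt_trans i1 (ltry _))|exact: (le_lt_trans i2 (ltry _))].
have mEf D : measurable_fun D (EFin \o f).
  by apply/measurable_EFinP; exact: measurable_funTS.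
have dI : [disjoint I1 & I2].
  apply/eqP; rewrite -subset0 => x [] /=; rewrite /I1 /I2/= !in_itv/= andbT => /andP[_ x1].
  by rewrite ltNge x1.
have IU : I1 `|` I2 = `]0, +oo[%classic.
  apply/seteqP; split => x /=; rewrite /I1 /I2/= !in_itv/= !andbT.
    by move=> [/andP[]//|]; exact: lt_trans.
  by move=> x0; have [x1|x1] := leP x 1; [left; rewrite x0|right].
have <- := @ge0_integral_setU _ _ _ mu I1 I2 (measurable_itv _)
  (measurable_itv _) (EFin \o f) (mEf _) (fun x _ => f0 x) dI.
rewrite IU integral_itv_obnd_cbnd//.
rewrite [leRHS]integral_mkcond/=; apply: ge0_le_integral => //.
- by move=> x _; rewrite lee_fin.
- exact: mEf.
- by apply/(measurable_restrictT _ (measurable_itv _)); exact: mEf.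
- move=> x _; rewrite patchE; case: ifPn; first by [].
  by rewrite notin_setE/= in_itv/= andbT => /negP/negbTE; rewrite /f => ->.
Qed.

End PowerKernels.

(** * The one-dimensional operator at a minimum *)

Section OneDimensional.
Context {R : realType} (s : R).
Hypothesis hs : 0 < s < 1.
Local Notation mu := (@lebesgue_measure R).
Local Notation intg f := (mu.-integrable setT (EFin \o f)).
Implicit Types f g h w : R -> R.

Definition singular_kernel (t : R) : R := (`|t| `^ (1 + 2 * s))^-1.

(** The integral in [frac_dir] for the restriction of a function to a line, at
    the parameter 0 and without the normalising constant. *)
Definition frac1 f : R :=
  \int[mu]_t ((f t + f (- t) - 2 * f 0) * singular_kernel t).

(** Enough for the integral [frac1] to converge absolutely: the quadratic bound
    serves at the origin, the uniform bound at infinity. *)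
Definition tame f :=
  [/\ continuous f, exists M, forall t, `|f t| <= M &
      exists C, forall t, `|t| <= 1 -> `|f t + f (- t) - 2 * f 0| <= C * t ^+ 2].

Let s2 : 0 < 1 + 2 * s. Proof. by case/andP: hs => *; lra. Qed.

Lemma singular_kernel_ge0 t : 0 <= singular_kernel t.
Proof. by rewrite invr_ge0 powR_ge0. Qed.

Lemma singular_kernel_gt0 t : t != 0 -> 0 < singular_kernel t.
Proof. by move=> t0; rewrite invr_gt0 powR_gt0// normr_gt0. Qed.

Lemma singular_kernelN t : singular_kernel (- t) = singular_kernel t.
Proof. by rewrite /singular_kernel normrN. Qed.

Lemma singular_kernel0 : singular_kernel 0 = 0.
Proof. by rewrite /singular_kernel normr0 powR0 ?invr0// gt_eqF. Qed.

Lemma singular_kernel_le t t' : t != 0 -> `|t| <= `|t'| -> singular_kernel t' <= singular_kernel t.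
Proof.
move=> t0 tt'; rewrite lef_pV2 ?posrE ?powR_gt0 ?normr_gt0//.
  by apply: ge0_ler_powR; rewrite ?nnegrE// ltW.
by rewrite -normr_gt0 (lt_le_trans _ tt')// normr_gt0.
Qed.

Lemma singular_kernel_lt t t' : t != 0 -> `|t| < `|t'| -> singular_kernel t' < singular_kernel t.
Proof.
move=> t0 tt'; rewrite ltf_pV2 ?posrE ?powR_gt0 ?normr_gt0//.
  by apply: gt0_ltr_powR; rewrite ?nnegrE.
by rewrite -normr_gt0 (lt_trans _ tt')// normr_gt0.
Qed.

Lemma singular_kernel_continuous t : t != 0 -> {for t, continuous singular_kernel}.
Proof.
move=> t0; apply: cvgV; first by rewrite gt_eqF// powR_gt0// normr_gt0.
have cp : {for `|t|, continuous (fun y => y `^ (1 + 2 * s))}.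
  apply: differentiable_continuous; apply/derivable1_diffP.
  by apply: derivable_powR; rewrite in_itv/= andbT normr_gt0.
by apply: (continuous_comp _ cp); exact: (@norm_continuous R R).
Qed.

Lemma measurable_singular_kernel : measurable_fun setT singular_kernel.
Proof.
rewrite (_ : singular_kernel = fun t => `|t| `^ (- (1 + 2 * s))).
  by apply: (measurableT_comp (measurable_powR _)); exact: normr_measurable.
by apply/funext => t; rewrite powRN.
Qed.

Lemma sqr_singular_kernel t : t != 0 -> t ^+ 2 * singular_kernel t = `|t| `^ (1 - 2 * s).
Proof.
move=> t0; rewrite /singular_kernel -real_normK ?num_real// -powR_mulrn//.
rewrite -powRN -powRD; first by congr (_ `^ _); ring.
by rewrite normr_eq0 t0 implybT.
Qed.

Lemma integrable_singular_kernel f (C : R) : measurable_fun setT f ->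
  (forall t, `|f t| <= C * Num.min 1 (t ^+ 2)) ->
  intg (fun t => f t * singular_kernel t).
Proof.
move=> mf fC; case/andP: hs => s0 s1.
have C0 : 0 <= C.
  have := fC 1; rewrite expr1n minxx mulr1; exact: le_trans.
apply: (@integrable_le _ _ (fun t => C * power_kernel (1 - 2 * s) (1 + 2 * s) t)).
- by apply: measurable_funM => //; exact: measurable_singular_kernel.
- move=> t; rewrite normrM (ger0_norm (singular_kernel_ge0 t)).
  have [->|t0] := eqVneq t 0; first by rewrite singular_kernel0 mulr0 mulr_ge0// power_kernel_ge0.
  apply: (le_trans (ler_wpM2r (singular_kernel_ge0 t) (fC t))); rewrite -mulrA ler_wpM2l//.
  rewrite /power_kernel; case: ifPn => t1.
    by rewrite -sqr_singular_kernel// ler_wpM2r ?singular_kernel_ge0// ge_min lexx orbT.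
  by rewrite powRN -[leRHS]mul1r ler_wpM2r ?singular_kernel_ge0// ge_min lexx.
- have pk : intg (power_kernel (1 - 2 * s) (1 + 2 * s)) by apply: integrable_power_kernel; lra.
  exact: (integrableZl measurableT C pk).
Qed.

Lemma integrable_frac1 f : tame f ->
  intg (fun t => (f t + f (- t) - 2 * f 0) * singular_kernel t).
Proof.
move=> [cf [M fM] [C fC]].
have M0 : 0 <= M by apply: le_trans (fM 0).
have C0 : 0 <= C by have := fC 1; rewrite normr1 lexx expr1n mulr1 => /(_ isT); exact: le_trans.
have mf : measurable_fun setT f by exact: continuous_measurable_fun.
apply: (@integrable_singular_kernel _ (C + 4 * M)).
  apply: measurable_funB => //; apply: measurable_funD => //.
  by apply: (measurableT_comp mf).
move=> t; have [t1|t1] := leP `|t| 1.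
  rewrite min_r; last by rewrite -real_normK ?num_real// expr_le1.
  apply: le_trans (fC t t1) _; rewrite ler_wpM2r ?sqr_ge0//; lra.
rewrite min_l; last by rewrite -real_normK ?num_real// expr_ge1// ltW.
move: (fM t) (fM (- t)) (fM 0); rewrite !ler_norml => /andP[a1 a2] /andP[b1 b2] /andP[c1 c2].
by apply/andP; split; lra.
Qed.

Lemma tameB f g : tame f -> tame g -> tame (fun t => f t - g t).
Proof.
move=> [cf [M fM] [C fC]] [cg [M' gM] [C' gC]]; split.
- by move=> x; apply: cvgB; [exact: cf|exact: cg].
- by exists (M + M') => t; rewrite (le_trans (ler_normB _ _))// lerD.
- exists (C + C') => t t1.
  rewrite (_ : _ - _ = (f t + f (- t) - 2 * f 0) - (g t + g (- t) - 2 * g 0)); last by ring.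
  by apply: (le_trans (ler_normB _ _)); rewrite [leRHS]mulrDl lerD ?fC ?gC.
Qed.

Lemma tameN f : tame f -> tame (fun t => f (- t)).
Proof.
move=> [cf [M fM] [C fC]]; split.
- by move=> x; apply: (@continuous_comp _ _ _ (fun x => - x) f); [exact: opp_continuous|exact: cf].
- by exists M.
- by exists C => t t1; rewrite opprK oppr0 (addrC (f (- t))); exact: fC.
Qed.

Lemma frac1N f : frac1 (fun t => f (- t)) = frac1 f.
Proof.
by apply: eq_Rintegral => t _; rewrite opprK oppr0 (addrC (f (- t))).
Qed.

Lemma frac1B f g : tame f -> tame g ->
  frac1 (fun t => f t - g t) = frac1 f - frac1 g.
Proof.
move=> tf tg; rewrite /frac1 -RintegralB//; [|exact: integrable_frac1..].
by apply: eq_Rintegral => t _; ring.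
Qed.

Lemma frac1_min_ge0 h : (forall t, h 0 <= h t) -> 0 <= frac1 h.
Proof.
move=> h0; apply: Rintegral_ge0 => t _; rewrite mulr_ge0 ?singular_kernel_ge0//.
by have := h0 t; have := h0 (- t); lra.
Qed.

Lemma frac1_min_eq0 h : tame h -> (forall t, h 0 <= h t) -> frac1 h = 0 ->
  forall t, h t = h 0.
Proof.
move=> th h0 fh0 t; apply/eqP; rewrite eq_le h0 andbT leNgt; apply/negP => ht.
have t0 : t != 0 by apply: contraTneq ht => ->; rewrite ltxx.
pose G x := (h x + h (- x) - 2 * h 0) * singular_kernel x.
have Gt : 0 < G t.
  by rewrite mulr_gt0 ?singular_kernel_gt0//; have := h0 (- t); lra.
have cG : {for t, continuous G}.
  have [ch _ _] := th.
  apply: cvgM; last exact: singular_kernel_continuous.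
  apply: cvgB; last exact: cvg_cst.
  apply: cvgD; first exact: ch.
  by apply: (@continuous_comp _ _ _ (fun x => - x) h); [exact: opp_continuous|exact: ch].
have : 0 < frac1 h.
  apply: (@Rintegral_gt0 _ _ t (G t / 2)).
  - move=> x; rewrite mulr_ge0 ?singular_kernel_ge0//.
    by have := h0 x; have := h0 (- x); lra.
  - exact: integrable_frac1.
  - by rewrite divr_gt0.
  - by apply: (cvgr_ge _ cG); lra.
by rewrite fh0 ltxx.
Qed.

(** The function w lives on a line that crosses a hyperplane at the parameter d,
    is odd about d, and on the near side of d has its minimum at 0. The values on
    the far side are those of the near side with the opposite sign, so reflecting
    that half of the integral weighs w - w 0 on the near side by the difference of
    the kernel and its mirror image, which is positive, and adds a positive
    multiple of - w 0. *)
Section Antisymmetric.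
Variables (w : R -> R) (d : R).
Hypotheses (d0 : 0 < d) (tw : tame w) (aw : forall t, w (2 * d - t) = - w t).
Hypothesis wmin : forall t, t < d -> w 0 <= w t.
Hypothesis w0 : w 0 <= 0.

Let h t := w t - w 0.
(* The integrand of [frac1 w] after the far side has been folded back, up to the
   symmetrisation t <-> - t. *)
Let H t := if t < d then h t * (singular_kernel t - singular_kernel (2 * d - t)) - 2 * w 0 * singular_kernel (2 * d - t)
           else if t == d then - w 0 * singular_kernel d else 0.

Let wd : w d = 0.
Proof. by have := aw d; rewrite (_ : 2 * d - d = d); [lra|ring]. Qed.

Let singular_kernel_refl t : t < d -> t != 0 -> singular_kernel (2 * d - t) < singular_kernel t.
Proof.
move=> td t0; apply: singular_kernel_lt => //.
have d0' := d0; have dt : 0 < 2 * d - t by lra.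
by rewrite [ltRHS]gtr0_norm// ltr_norml; apply/andP; split; lra.
Qed.

Let H_ge t : t < d -> t != 0 -> - 2 * w 0 * singular_kernel (2 * d - t) <= H t.
Proof.
have d0' := d0; have w0' := w0.
move=> td t0; rewrite /H td mulNr mulNr lerDr mulr_ge0//.
  by rewrite subr_ge0 wmin.
by rewrite subr_ge0 ltW// singular_kernel_refl.
Qed.

Let H_ge0 t : 0 <= H t.
Proof.
have d0' := d0; have w0' := w0.
have [->|t0] := eqVneq t 0.
  by rewrite /H d0 /h subrr mul0r sub0r -mulNr mulr_ge0 ?singular_kernel_ge0//; lra.
have [td|td] := ltP t d.
  by apply: le_trans (H_ge td t0); rewrite mulr_ge0 ?singular_kernel_ge0//; lra.
rewrite /H ltNge td/=; case: ifP => // _; rewrite mulr_ge0 ?singular_kernel_ge0//; lra.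
Qed.

Let integrable_H2 : intg (fun t => H t + H (- t)) /\ frac1 w = \int[mu]_t (H t + H (- t)).
Proof.
have d0' := d0; have w0' := w0.
have [cw [M wM] _] := tw.
have mw : measurable_fun setT w by exact: continuous_measurable_fun.
(* P is the far half of the integrand and Q its mirror image, with the same
   integral. *)
pose P t := if t < d then 0 else h t * singular_kernel t.
have mP : measurable_fun setT P.
  apply: measurable_fun_ifT => //; first exact: measurable_fun_ltr.
  by apply: measurable_funM; [exact: measurable_funB|exact: measurable_singular_kernel].
have Pi : intg P.
  case/andP: hs => s0 s1.
  have M0 : 0 <= M by apply: le_trans (wM 0).
  pose c := Num.min 1 (d ^+ 2).
  have c0 : 0 < c by rewrite lt_min ltr01 exprn_gt0.
  have -> : P = fun t => (if t < d then 0 else h t) * singular_kernel t.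
    by apply/funext => t; rewrite /P; case: ifP; rewrite ?mul0r.
  apply: (@integrable_singular_kernel _ (2 * M / c)).
    by apply: measurable_fun_ifT => //; [exact: measurable_fun_ltr|exact: measurable_funB].
  move=> t; case: ifPn => [_|]; last rewrite -leNgt => dt.
    rewrite normr0 mulr_ge0//; last by rewrite le_min ler01 sqr_ge0.
    by rewrite divr_ge0 ?(ltW c0)// mulr_ge0.
  apply: (@le_trans _ _ (2 * M)).
    by rewrite /h (le_trans (ler_normB _ _))//; have := wM t; have := wM 0; lra.
  rewrite mulrAC -[leRHS]mulrA ler_peMr ?mulr_ge0//.
  rewrite ler_pdivlMr// mul1r /c le_min ge_min lexx/= ge_min.
  have t0 : 0 <= t by apply: le_trans dt; exact: ltW.
  by rewrite ler_pXn2r ?nnegrE ?(ltW d0')// ?dt ?orbT.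
pose Q t := P (2 * d + (-1) * t).
have Qi : intg Q by apply: integrable_affine => //; rewrite oppr_eq0 oner_eq0.
have PN : intg (fun t => P (0 + (-1) * t)).
  by apply: integrable_affine => //; rewrite oppr_eq0 oner_eq0.
have QN : intg (fun t => Q (0 + (-1) * t)).
  by apply: integrable_affine => //; rewrite oppr_eq0 oner_eq0.
have G := integrable_frac1 tw.
have n1 : (-1 : R) != 0 by rewrite oppr_eq0 oner_eq0.
have E : (fun t => H t + H (- t)) = (fun t => ((w t + w (- t) - 2 * w 0) * singular_kernel t
   - (P t + P (0 + (-1) * t))) + (Q t + Q (0 + (-1) * t))).
  suff HE t : H t = h t * singular_kernel t - P t + Q t.
    apply/funext => t; rewrite !HE add0r mulN1r /h singular_kernelN; ring.
  rewrite /H /Q /P mulN1r; case: (ltgtP t d) => td.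
  - have -> : 2 * d - t < d = false by apply/negbTE; rewrite -leNgt; lra.
    rewrite /h aw; ring.
  - have -> : 2 * d - t < d by lra.
    ring.
  - rewrite td (_ : 2 * d - d = d); last by ring.
    by rewrite ltxx /h wd; ring.
have PPi : intg (fun t => P t + P (0 + (-1) * t)) by exact: (integrableD measurableT Pi PN).
have QQi : intg (fun t => Q t + Q (0 + (-1) * t)) by exact: (integrableD measurableT Qi QN).
have GPi := integrableB measurableT G PPi.
split; first by rewrite E; exact: (integrableD measurableT GPi QQi).
rewrite E RintegralD// RintegralB// !RintegralD// !Rintegral_affine//.
by rewrite normrN normr1 invr1 !mul1r -/(frac1 w); ring.
Qed.

(** The integrand is nonnegative, so the interval [d/4, d/2] alone gives the
    bound; it scales like d^(-2s). *)
Lemma frac1_antisym_ge : - w 0 * singular_kernel (2 * d) * (d / 2) <= frac1 w.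
Proof.
have d0' := d0; have w0' := w0.
have [Hi ->] := integrable_H2.
rewrite (_ : - w 0 * _ * _ = - 2 * w 0 * singular_kernel (2 * d) * (d / 2 - d / 4)); last by field.
apply: Rintegral_ge_itv => //.
- by move=> x; rewrite addr_ge0.
- lra.
- by rewrite mulr_ge0 ?singular_kernel_ge0//; lra.
- move=> t /andP[td1 td2]; rewrite -[leLHS]addr0 lerD//.
  have t0 : t != 0 by rewrite gt_eqF//; lra.
  apply: le_trans (H_ge _ t0); last by lra.
  rewrite ler_wpM2l//; first by lra.
  by apply: singular_kernel_le; [rewrite gt_eqF//|rewrite !ger0_norm]; lra.
Qed.

(** Strict monotonicity of the kernel turns a vanishing integral into the
    vanishing of w. *)
Lemma frac1_antisym_eq0 : w 0 = 0 -> frac1 w = 0 -> forall t, t < d -> w t = 0.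
Proof.
have d0' := d0; have w0' := w0.
move=> ww0 fw0 t td; apply/eqP; rewrite eq_le -{2}ww0 wmin// andbT leNgt.
apply/negP => wt; have [Hi] := integrable_H2; rewrite fw0 => Hi0.
have t0 : t != 0 by apply: contraTneq wt => ->; rewrite ww0 ltxx.
pose F x := h x * (singular_kernel x - singular_kernel (2 * d - x)).
have Ft : 0 < F t.
  by rewrite mulr_gt0 ?subr_gt0 ?singular_kernel_refl// ww0.
have cF : {for t, continuous F}.
  have [cw _ _] := tw.
  apply: cvgM; first by apply: cvgB; [exact: cw|exact: cvg_cst].
  apply: cvgB; first exact: singular_kernel_continuous.
  apply: (@continuous_comp _ _ _ (fun x => 2 * d - x) singular_kernel).
    by apply: cvgB; [exact: cvg_cst|exact: cvg_id].
  by apply: singular_kernel_continuous; rewrite gt_eqF//; lra.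
have : 0 < \int[mu]_t (H t + H (- t)).
  apply: (@Rintegral_gt0 _ _ t (F t / 2)) => //.
  - by move=> x; rewrite addr_ge0.
  - by rewrite divr_gt0.
  - have Fn : \forall x \near t, F t / 2 <= F x by apply: (cvgr_ge _ cF); lra.
    near=> x; have xd : x < d by near: x; exact: lt_nbhsl.
    rewrite -[leLHS]addr0 lerD ?H_ge0// /H xd ww0 mulr0 mul0r subr0.
    by near: x.
by rewrite -Hi0 ltxx.
Unshelve. all: by end_near. Qed.

End Antisymmetric.
End OneDimensional.

(** * Reflections, lines and Taylor estimates *)

Section Geometry.
Context {R : realType} {N : nat}.
Implicit Types (x y : 'rV[R]_N) (i j : 'I_N) (l : R).

Lemma enorm_ge0 x : 0 <= enorm x.
Proof. exact: sqrtr_ge0. Qed.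

Lemma coord_le_enorm x i : `|x 0 i| <= enorm x.
Proof.
rewrite -sqrtr_sqr ler_sqrt; last by apply: sumr_ge0 => k _; exact: sqr_ge0.
by rewrite (bigD1 i)//= lerDl sumr_ge0// => k _; exact: sqr_ge0.
Qed.

Lemma norm_le_enorm x : `|x| <= enorm x.
Proof.
rewrite [leLHS]/Num.norm /= mx_normrE; apply/bigmax_leP; split; first exact: enorm_ge0.
by move=> [k j] _ /=; rewrite (ord1 k); exact: coord_le_enorm.
Qed.

Lemma enorm_continuous : continuous (@enorm R N).
Proof.
have cS : forall r : seq 'I_N, continuous (fun x : 'rV[R]_N => \sum_(i <- r) x 0 i ^+ 2).
  elim=> [|k r IH] x.
    by rewrite (_ : (fun _ => _) = cst 0); [exact: cst_continuous|apply/funext => y; rewrite big_nil].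
  rewrite (_ : (fun _ => _) = (fun y : 'rV[R]_N => y 0 k ^+ 2 + \sum_(i <- r) y 0 i ^+ 2)).
    apply: (continuousD _ (IH x)).
    exact: (continuous_comp (@coord_continuous R 1 N 0 k x) (@exprn_continuous R 2 _)).
  by apply/funext => y; rewrite big_cons.
move=> x; exact: (continuous_comp (cS _ x) (@sqrt_continuous R _)).
Qed.

Lemma compact_enorm_le (M : R) (A : set 'rV[R]_N) : closed A ->
  compact [set x | enorm x <= M /\ A x].
Proof.
move=> cA; apply: bounded_closed_compact.
  exists M; split; first exact: num_real.
  by move=> m Mm x [xM _] /=; rewrite (le_trans (norm_le_enorm x))// (le_trans xM)// ltW.
apply: closedI => //.
apply: (@closed_comp _ _ (@enorm R N) [set t | t <= M]); last exact: closed_le.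
by move=> x _; exact: enorm_continuous.
Qed.

Lemma ebasisE i j : (ebasis R i) 0 j = (i == j)%:R.
Proof. by rewrite /ebasis mxE eqxx /= eq_sym. Qed.

Lemma line_coord x i j (t : R) : (x + t *: ebasis R i) 0 j = x 0 j + (i == j)%:R * t.
Proof. by rewrite !mxE eqxx/= eq_sym mulrC. Qed.

Lemma enorm_line (t : R) i : enorm (t *: ebasis R i) = `|t|.
Proof.
rewrite /enorm (bigD1 i)//= big1 ?addr0.
  by rewrite !mxE !eqxx mulr1 sqrtr_sqr.
by move=> j ji; rewrite !mxE eqxx/= (negbTE ji) mulr0 expr0n.
Qed.

Definition mirror i l x := x - (2 * (x 0 i - l)) *: ebasis R i.

Lemma mirror_coord i l x j : (mirror i l x) 0 j = if i == j then 2 * l - x 0 i else x 0 j.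
Proof.
rewrite /mirror -scaleNr line_coord; case: eqVneq => [<-|_]; last by rewrite mul0r addr0.
by rewrite mul1r; ring.
Qed.

Lemma mirrorK i l : involutive (mirror i l).
Proof.
move=> x; apply/rowP => j; rewrite !mirror_coord eqxx.
by case: eqVneq => // <-; ring.
Qed.

Lemma mirror_line i l x j (t : R) : j != i ->
  mirror i l (x + t *: ebasis R j) = mirror i l x + t *: ebasis R j.
Proof.
move=> ji; apply/rowP => k; rewrite line_coord !mirror_coord !line_coord.
by rewrite (negbTE ji) mul0r addr0; case: eqVneq => // <-; rewrite (negbTE ji) mul0r addr0.
Qed.

Lemma mirror_linei i l x (t : R) :
  mirror i l (x + t *: ebasis R i) = mirror i l x + (- t) *: ebasis R i.
Proof.
apply/rowP => k; rewrite line_coord !mirror_coord !line_coord eqxx.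
by case: eqVneq => _ /=; ring.
Qed.

Lemma mirror_line_refl i l x (t : R) :
  x + (2 * (l - x 0 i) - t) *: ebasis R i = mirror i l (x + t *: ebasis R i).
Proof.
apply/rowP => k; rewrite mirror_coord !line_coord eqxx.
by case: eqVneq => [<-|_] /=; ring.
Qed.

Lemma mirror_fix i l x : x 0 i = l -> mirror i l x = x.
Proof. by move=> xl; rewrite /mirror xl subrr mulr0 scale0r subr0. Qed.

Lemma mirror_continuous2 i : continuous (fun z : 'rV[R]_N * R => mirror i z.2 z.1).
Proof.
have c1 : continuous (fun z : 'rV[R]_N * R => z.1) by move=> ?; exact: cvg_fst.
have c2 : continuous (fun z : 'rV[R]_N * R => z.2) by move=> ?; exact: cvg_snd.
have c3 : continuous (fun z : 'rV[R]_N * R => z.1 0 i).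
  by move=> z; exact: (continuous_comp (c1 z) (@coord_continuous R 1 N 0 i _)).
move=> z; apply: (continuousB (c1 z)).
have c4 : {for z, continuous (fun z : 'rV[R]_N * R => 2 * (z.1 0 i - z.2))}.
  by apply: (continuousM _ (continuousB (c3 z) (c2 z))); exact: cst_continuous.
exact: (cvgZr_tmp c4).
Qed.

Lemma mirror_continuous i l : continuous (mirror i l).
Proof.
have c : continuous (fun x : 'rV[R]_N => (x, l)).
  move=> x; apply: (cvg_pair (F := nbhs x) (G := nbhs x) (H := nbhs l)).
    exact: cvg_id.
  exact: cvg_cst.
by move=> x; exact: (continuous_comp (c x) (@mirror_continuous2 i _)).
Qed.

Lemma mirror_continuousr i x : continuous (fun l => mirror i l x).
Proof.
have c : continuous (fun l : R => (x, l)).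
  move=> l; apply: (cvg_pair (F := nbhs l) (G := nbhs x) (H := nbhs l)).
    exact: cvg_cst.
  exact: cvg_id.
by move=> l; exact: (continuous_comp (c l) (@mirror_continuous2 i _)).
Qed.

Lemma line_continuous x j : continuous (fun t : R => x + t *: ebasis R j).
Proof. by move=> t; apply: cvgD; [exact: cvg_cst|apply: cvgZr_tmp; exact: cvg_id]. Qed.

End Geometry.

Section Taylor.
Context {R : realType}.

(** The part of C^2 regularity that the integrals need. Unlike a bound on second
    differences it is stable under the nonlinear changes of the increment that
    occur along lines missing the centre. *)
Definition loc_taylor (f : R -> R) := exists f1 : R -> R,
  forall A, exists2 C, 0 <= C & forall a b, `|a| <= A -> `|b| <= A ->
    `|f b - f a - f1 a * (b - a)| <= C * (b - a) ^+ 2.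

Lemma loc_taylor_C2 (f f1 f2 : R -> R) : (forall t : R, is_derive t 1 f (f1 t)) ->
  (forall t : R, is_derive t 1 f1 (f2 t)) -> continuous f2 -> loc_taylor f.
Proof.
move=> d1 d2 c2; exists f1 => A.
have MV (g g' : R -> R) : (forall t : R, is_derive t 1 g (g' t)) -> forall a b,
    exists2 c, Num.min a b <= c <= Num.max a b & g b - g a = g' c * (b - a).
  move=> dg a b.
  have cg : continuous g.
    by move=> x; apply: differentiable_continuous; apply/derivable1_diffP; have [] := dg x.
  have [ab|ba|->] := ltgtP a b.
  - have [c] := @MVT _ g g' a b ab (fun x _ => dg x) (continuous_subspaceT cg).
    by rewrite in_itv/= => /andP[/ltW ? /ltW ?] ->; exists c => //; apply/andP.
  - have [c] := @MVT _ g g' b a ba (fun x _ => dg x) (continuous_subspaceT cg).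
    rewrite in_itv/= => /andP[/ltW ? /ltW ?] E; exists c; first by apply/andP.
    by rewrite -opprB E -mulrN opprB.
  - by exists b; rewrite ?lexx// !subrr mulr0.
have [A0|A0] := ltP A 0.
  by exists 0 => // a b aA; have := le_lt_trans aA A0; rewrite normr_lt0.
have AA : - A <= A by lra.
have [c _ cM] := @EVT_max _ (fun t => `|f2 t|) _ _ AA (continuous_subspaceT
  (fun x => cvg_norm (c2 x))).
exists `|f2 c| => // a b aA bA.
have [x /andP[x1 x2] ->] := MV f f1 d1 a b.
have [y /andP[y1 y2] E] := MV f1 f2 d2 a x.
have /andP[a1 a2] : - A <= a <= A by rewrite -ler_norml.
have /andP[b1 b2] : - A <= b <= A by rewrite -ler_norml.
have xa : `|x - a| <= `|b - a|.
  move: x1 x2; case: (lerP a b) => ab x1 x2.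
    by rewrite !ger0_norm; lra.
  by rewrite !ler0_norm; lra.
have xA : - A <= x <= A.
  by move: x1 x2; case: (lerP a b) => ab x1 x2; apply/andP; split; lra.
have yA : - A <= y <= A.
  case/andP: xA => xA1 xA2.
  by move: y1 y2; case: (lerP a x) => ax y1 y2; apply/andP; split; lra.
rewrite -mulrBl E -(real_normK (num_real (b - a))) expr2.
rewrite !normrM -mulrA; apply: ler_pM => //.
  by apply: cM; rewrite in_itv.
by rewrite ler_wpM2r.
Qed.

End Taylor.

(** * Second differences of radial functions and of truncated cones *)

Section Profile.
Context {R : realType} (s : R).
Hypothesis hs : 0 < s < 1.
Local Notation mu := (@lebesgue_measure R).
Local Notation intg f := (mu.-integrable setT (EFin \o f)).

(** The length of f + t e for unit vectors e and f of inner product b / 2: how the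
    distance to the centre varies along a line through the unit sphere. *)
Definition shift_norm (b t : R) : R := Num.sqrt (1 + b * t + t ^+ 2).

(** The second difference of the radial function of profile V along such a line,
    compared with the tangent line at the same point (b = 0). Subtracting
    the latter, rather than 2 V 1, keeps the difference bounded for large t when
    V grows linearly. *)
Definition diff2 (b : R) (V : R -> R) (t : R) : R :=
  V (shift_norm b t) + V (shift_norm (- b) t) - 2 * V (shift_norm 0 t).

Definition diff2_int (b : R) (V : R -> R) : R := \int[mu]_t (diff2 b V t * singular_kernel s t).

Lemma shift_norm_ge0 b t : 0 <= shift_norm b t. Proof. exact: sqrtr_ge0. Qed.

Lemma shift_norm_sqr b t : `|b| <= 2 -> shift_norm b t ^+ 2 = 1 + b * t + t ^+ 2.
Proof.
rewrite ler_norml => /andP[b1 b2]; rewrite sqr_sqrtr//.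
rewrite (_ : 1 + _ + _ = (1 + b / 2 * t) ^+ 2 + (2 - b) * (2 + b) / 4 * t ^+ 2); last by field.
by rewrite addr_ge0 ?sqr_ge0// mulr_ge0 ?sqr_ge0// divr_ge0// mulr_ge0; lra.
Qed.

Lemma shift_norm_continuous b : continuous (shift_norm b).
Proof.
have cp : continuous (fun t : R => 1 + b * t + t ^+ 2).
  move=> t; have c1 : {for t, continuous (fun x => b * x)} by exact: mulrl_continuous.
  have c0 : {for t, continuous (fun _ : R => 1 : R)} by exact: cst_continuous.
  exact: (continuousD (continuousD c0 c1) (@exprn_continuous R 2 t)).
by move=> t; exact: (continuous_comp (cp t) (@sqrt_continuous R _)).
Qed.

Lemma measurable_shift_norm b : measurable_fun setT (shift_norm b).
Proof. by apply: continuous_measurable_fun; exact: shift_norm_continuous. Qed.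

Lemma shift_norm_sub1 b t : `|b| <= 2 -> `|shift_norm b t - 1| <= `|t|.
Proof.
move=> b2; have aE := shift_norm_sqr t b2; have a0 := shift_norm_ge0 b t.
have /andP[bt1 bt2] : - (2 * `|t|) <= b * t <= 2 * `|t|.
  by rewrite -ler_norml normrM ler_wpM2r.
have tt : t ^+ 2 = `|t| ^+ 2 by rewrite real_normK// num_real.
have n0 := normr_ge0 t; move: aE a0; rewrite tt; move: (shift_norm b t) => a aE a0.
rewrite ler_norml; apply/andP; split.
  have [t1|t1] := lerP `|t| 1; last lra.
  suff : 1 - `|t| <= a by lra.
  by rewrite -(ler_pXn2r (n := 2)) ?nnegrE ?subr_ge0// aE sqrrB; lra.
suff : a <= 1 + `|t| by lra.
by rewrite -(ler_pXn2r (n := 2)) ?nnegrE ?addr_ge0// aE sqrrD; lra.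
Qed.

Lemma shift_norm_sub0 b t : `|b| <= 2 -> `|shift_norm b t - shift_norm 0 t| <= 2.
Proof.
move=> b2; have b0 : `|0 : R| <= 2 by rewrite normr0.
have := shift_norm_sqr t b2; have := shift_norm_sqr t b0.
have := shift_norm_ge0 b t; have := shift_norm_ge0 0 t.
move: b2; rewrite ler_norml => /andP[b1 b2].
set a := shift_norm b t; set q := shift_norm 0 t => q0 a0 qE aE.
have qt : `|t| <= q by rewrite -sqrtr_sqr ler_wsqrtr//; lra.
have [t0|t0] := eqVneq t 0.
  have -> : a = q.
    by apply/eqP; rewrite -(eqrXn2 (n := 2))// aE qE t0 !mulr0.
  by rewrite subrr normr0.
have t1 : 0 < `|t| by rewrite normr_gt0.
rewrite -(ler_pM2r t1); apply: (@le_trans _ _ (`|a - q| * (a + q))).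
  by rewrite ler_wpM2l//; lra.
rewrite -{1}(ger0_norm (addr_ge0 a0 q0)) -normrM.
rewrite (_ : (a - q) * (a + q) = b * t); last by rewrite -subr_sqr aE qE; ring.
by rewrite normrM ler_wpM2r// ler_norml b1.
Qed.

(** The squares of the three lengths combine to zero. *)
Lemma diff2_idE b t : `|b| <= 2 -> diff2 b id t =
  - ((shift_norm b t - 1) ^+ 2 + (shift_norm (- b) t - 1) ^+ 2 - 2 * (shift_norm 0 t - 1) ^+ 2) / 2.
Proof.
move=> b2; have b0 : `|0 : R| <= 2 by rewrite normr0.
have b2' : `|- b| <= 2 by rewrite normrN.
have := shift_norm_sqr t b2; have := shift_norm_sqr t b2'; have := shift_norm_sqr t b0; rewrite /diff2.
by move: (shift_norm b t) (shift_norm (- b) t) (shift_norm 0 t) => x y z hz hy hx; lra.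
Qed.

Lemma sqr_le_norm (x y : R) : `|x| <= `|y| -> x ^+ 2 <= y ^+ 2.
Proof. by move=> xy; rewrite -(real_normK (num_real x)) -(real_normK (num_real y)) ler_pXn2r ?nnegrE. Qed.

Lemma diff2_id_le b t : `|b| <= 2 -> `|diff2 b id t| <= 2 * t ^+ 2.
Proof.
move=> b2; have b0 : `|0 : R| <= 2 by rewrite normr0.
have b2' : `|- b| <= 2 by rewrite normrN.
rewrite diff2_idE//.
have := sqr_le_norm (shift_norm_sub1 t b2); have := sqr_le_norm (shift_norm_sub1 t b2').
have := sqr_le_norm (shift_norm_sub1 t b0).
have := sqr_ge0 (shift_norm b t - 1); have := sqr_ge0 (shift_norm (- b) t - 1).
have := sqr_ge0 (shift_norm 0 t - 1) => *; rewrite ler_norml; apply/andP; split; lra.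
Qed.

(** The linear part of V contributes only through the cone, whose second
    difference is itself quadratic in t. *)
Lemma diff2_taylor b t (V : R -> R) (k C : R) : `|b| <= 2 -> `|t| <= 2^-1 ->
  (forall a, `|a - 1| <= 2^-1 -> `|V a - V 1 - k * (a - 1)| <= C * (a - 1) ^+ 2) ->
  0 <= C ->
  `|diff2 b V t| <= (2 * `|k| + 4 * C) * t ^+ 2.
Proof.
move=> b2 t2 HV C0; have b0 : `|0 : R| <= 2 by rewrite normr0.
have b2' : `|- b| <= 2 by rewrite normrN.
have E : diff2 b V t = k * diff2 b id t + (V (shift_norm b t) - V 1 - k * (shift_norm b t - 1))
   + (V (shift_norm (- b) t) - V 1 - k * (shift_norm (- b) t - 1))
   - 2 * (V (shift_norm 0 t) - V 1 - k * (shift_norm 0 t - 1)).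
  by rewrite /diff2; ring.
have aux c : `|c| <= 2 -> `|V (shift_norm c t) - V 1 - k * (shift_norm c t - 1)| <= C * t ^+ 2.
  move=> c2; apply: le_trans (HV _ _) _.
    exact: le_trans (shift_norm_sub1 t c2) t2.
  by rewrite ler_wpM2l// sqr_le_norm// shift_norm_sub1.
rewrite E; have := aux _ b2; have := aux _ b2'; have := aux _ b0.
have : `|k * diff2 b id t| <= `|k| * (2 * t ^+ 2).
  by rewrite normrM ler_wpM2l// diff2_id_le.
move: (k * _) (V _ - V 1 - _) (V _ - V 1 - _) (V _ - V 1 - _) => x1 x2 x3 x4.
rewrite !ler_norml => /andP[? ?] /andP[? ?] /andP[? ?] /andP[? ?].
by apply/andP; split; lra.
Qed.

(** For the cone the axis direction (inner products 1 and 0 with the basis) and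
    the diagonal one (inner products 1 / sqrt 2) differ strictly. With
    M = max 1 |t|, q = sqrt (1 + t^2) and a, b the two lengths for the diagonal,
    the claim is M + q < a + b, and squaring leaves only the product
    a b = sqrt (1 + t^4) to be compared with q. *)
Lemma diff2_id_lt t : t != 0 -> diff2 2 id t - 2 * diff2 (Num.sqrt 2) id t < 0.
Proof.
move=> t0; have b0 : `|0 : R| <= 2 by rewrite normr0.
have r2 : Num.sqrt 2 ^+ 2 = 2 :> R by rewrite sqr_sqrtr.
have r0 : 0 <= Num.sqrt 2 :> R by exact: sqrtr_ge0.
have b2 : `|Num.sqrt 2 : R| <= 2 by rewrite ger0_norm//; nra.
have b2' : `|- Num.sqrt 2 : R| <= 2 by rewrite normrN.
have := shift_norm_sqr t b2; have := shift_norm_sqr t b2'; have := shift_norm_sqr t b0.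
have := shift_norm_ge0 (Num.sqrt 2) t; have := shift_norm_ge0 (- Num.sqrt 2) t; have := shift_norm_ge0 0 t.
have e1 : shift_norm 2 t = `|1 + t|.
  by rewrite -sqrtr_sqr /shift_norm; congr Num.sqrt; ring.
have e2 : shift_norm (- 2) t = `|1 - t|.
  by rewrite -sqrtr_sqr /shift_norm; congr Num.sqrt; ring.
rewrite /diff2 e1 e2.
move: (shift_norm 0 t) (shift_norm (- Num.sqrt 2) t) (shift_norm (Num.sqrt 2) t) => q b a q0 b0' a0 qE bE aE.
have tt : 0 < t ^+ 2 by rewrite exprn_even_gt0.
have abE : (a * b) ^+ 2 = 1 + (t ^+ 2) ^+ 2.
  rewrite exprMn aE bE; transitivity ((1 + t ^+ 2) ^+ 2 - Num.sqrt 2 ^+ 2 * t ^+ 2).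
    by ring.
  by rewrite r2; ring.
have ab0 : 0 <= a * b by rewrite mulr_ge0.
have sumE : (a + b) ^+ 2 = 2 + 2 * t ^+ 2 + 2 * (a * b).
  by rewrite sqrrD aE bE; ring.
suff [M [M0 -> HM]] : exists M, [/\ 0 <= M, `|1 + t| + `|1 - t| = 2 * M & (M + q) ^+ 2 < (a + b) ^+ 2].
  have : M + q < a + b by rewrite -(ltr_pXn2r (n := 2)) ?nnegrE ?addr_ge0.
  lra.
have q2 : q ^+ 2 = 1 + t ^+ 2 by rewrite qE mul0r addr0.
have [t1|t1] := lerP `|t| 1.
  exists 1; split => //.
    by move: t1; rewrite ler_norml => /andP[? ?]; rewrite !ger0_norm; lra.
  have ab1 : 1 < a * b by rewrite -(ltr_pXn2r (n := 2)) ?nnegrE// abE expr1n ltrDl exprn_gt0.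
  have : 2 * q <= 2 + t ^+ 2 by nra.
  by rewrite sumE sqrrD q2 expr1n mul1r; lra.
exists `|t|; split => //.
  have [tp|tn] := lerP 0 t.
    by rewrite (ger0_norm tp) in t1 *; rewrite ger0_norm ?ler0_norm; lra.
  by rewrite (ltr0_norm tn) in t1 *; rewrite ler0_norm ?ger0_norm; lra.
have T2 : `|t| ^+ 2 = t ^+ 2 by rewrite real_normK// num_real.
have ab1 : t ^+ 2 < a * b by rewrite -(ltr_pXn2r (n := 2)) ?nnegrE ?sqr_ge0// abE; lra.
have tq : `|t| * q <= t ^+ 2 + 2^-1.
  rewrite -(ler_pXn2r (n := 2)) ?nnegrE ?mulr_ge0 ?addr_ge0 ?sqr_ge0//.
  by rewrite exprMn T2 q2 sqrrD; lra.
by rewrite sumE sqrrD q2 T2; lra.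
Qed.

(** The square makes truncated cones continuously differentiable. *)
Definition cutoff (v : R) : R := Num.max 0 (1 - v) ^+ 2.

(** For a > c this is (a - c)^2 / a = a - 2 c + c^2 / a, a convex function; below c it is
    zero. It tends to a as c tends to 0. *)
Definition cutoff_cone (c a : R) : R := a * cutoff (c / a).

Lemma cutoff_cone0 c : cutoff_cone c 0 = 0. Proof. by rewrite /cutoff_cone mul0r. Qed.

Lemma cutoff_cone_small c a : 0 <= a -> a <= c -> cutoff_cone c a = 0.
Proof.
rewrite le_eqVlt => /predU1P[<- _|a0 ac]; first exact: cutoff_cone0.
rewrite /cutoff_cone /cutoff max_l ?expr0n ?mulr0//.
by rewrite subr_le0 ler_pdivlMr// mul1r.
Qed.

Lemma cutoff_cone_large c a : 0 < a -> c <= a -> cutoff_cone c a = (a - c) ^+ 2 / a.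
Proof.
move=> a0 ca; rewrite /cutoff_cone /cutoff max_r; last by rewrite subr_ge0 ler_pdivrMr// mul1r.
by field; rewrite gt_eqF.
Qed.

Lemma cutoff_cone_near c a : 0 <= c -> 0 <= a -> `|a - cutoff_cone c a| <= 2 * c.
Proof.
move=> c0 a0; have [ac|ca] := leP a c.
  by rewrite cutoff_cone_small// subr0 ger0_norm//; lra.
have ap : 0 < a by apply: le_lt_trans ca.
rewrite (cutoff_cone_large ap (ltW ca)).
rewrite (_ : a - (a - c) ^+ 2 / a = c * (2 - c / a)); last by field; rewrite gt_eqF.
have : c / a <= 1 by rewrite ler_pdivrMr// mul1r ltW.
have : 0 <= c / a by rewrite divr_ge0.
move=> h1 h2; rewrite ger0_norm ?mulr_ge0//; last lra.
by rewrite mulrC ler_wpM2r//; lra.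
Qed.

Lemma cutoff_cone_lip c a a' : 0 <= c -> 0 <= a -> 0 <= a' -> `|cutoff_cone c a - cutoff_cone c a'| <= `|a - a'|.
Proof.
move=> c0; wlog aa : a a' / a' <= a.
  move=> H a0 a'0; have [aa|aa] := leP a' a; first exact: (H _ _ aa a0 a'0).
  by rewrite [leLHS]distrC [leRHS]distrC; exact: (H _ _ (ltW aa) a'0 a0).
move=> a0 a'0; rewrite [leRHS]ger0_norm ?subr_ge0//.
have [ac|ca] := lerP a c.
  by rewrite !cutoff_cone_small// ?(le_trans aa)// subrr normr0 subr_ge0.
have ap : 0 < a by apply: le_lt_trans ca.
rewrite (cutoff_cone_large ap (ltW ca)).
have [a'c|ca'] := lerP a' c.
  rewrite cutoff_cone_small// subr0 ger0_norm; last by rewrite divr_ge0// sqr_ge0.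
  by rewrite ler_pdivrMr//; nra.
have a'p : 0 < a' by apply: le_lt_trans ca'.
rewrite (cutoff_cone_large a'p (ltW ca')).
rewrite (_ : _ - _ = (a - a') * (1 - c ^+ 2 / (a * a'))); last by field; rewrite !gt_eqF.
have caa : c ^+ 2 / (a * a') <= 1 by rewrite ler_pdivrMr ?mulr_gt0// mul1r expr2 ler_pM// ltW.
have caa0 : 0 <= c ^+ 2 / (a * a') by rewrite divr_ge0 ?sqr_ge0// mulr_ge0.
rewrite ger0_norm; last by rewrite mulr_ge0// subr_ge0.
by rewrite ler_piMr ?subr_ge0//; lra.
Qed.

(** The coefficient Num.max 0 (1 - c^2) is the derivative at 1. *)
Lemma cutoff_cone_taylor c a : 0 <= c -> `|a - 1| <= 2^-1 ->
  `|cutoff_cone c a - cutoff_cone c 1 - Num.max 0 (1 - c ^+ 2) * (a - 1)| <= 4 * (a - 1) ^+ 2.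
Proof.
move=> c0; rewrite ler_norml => /andP[a1 a2].
have a0 : 0 < a by lra.
have [c1|c1] := lerP c 1.
  rewrite max_r; last by rewrite subr_ge0 expr_le1.
  rewrite (@cutoff_cone_large c 1)// divr1.
  have [ac|ca] := lerP a c.
    have x0 : 0 <= 1 - c by lra.
    have y0 : 0 <= 1 - a by lra.
    have h1 : (1 - c) ^+ 2 <= (1 - a) ^+ 2 by rewrite ler_pXn2r ?nnegrE//; lra.
    have h2 : (1 - c) * ((1 + c) * (1 - a)) <= (1 - a) * (2 * (1 - a)).
      apply: ler_pM => //; [by rewrite mulr_ge0//; lra|lra|].
      by rewrite ler_wpM2r//; lra.
    have z0 : 0 <= 1 + c by lra.
    have h3 : 0 <= (1 - c) * ((1 + c) * (1 - a)) by rewrite !mulr_ge0.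
    rewrite (cutoff_cone_small (ltW a0) ac) ler_norml; apply/andP; split; nra.
  rewrite (cutoff_cone_large a0 (ltW ca)).
  rewrite (_ : _ - _ - _ = c ^+ 2 / a * (a - 1) ^+ 2); last by field; rewrite gt_eqF.
  rewrite ger0_norm; last by rewrite mulr_ge0 ?sqr_ge0// divr_ge0 ?sqr_ge0// ltW.
  rewrite ler_wpM2r ?sqr_ge0// ler_pdivrMr//.
  have : c ^+ 2 <= 1 by rewrite expr_le1.
  lra.
rewrite max_l; last by rewrite subr_le0 expr_ge1// ltW.
rewrite mul0r subr0 (cutoff_cone_small ler01 (ltW c1)) subr0.
have [ac|ca] := lerP a c.
  by rewrite (cutoff_cone_small (ltW a0) ac) normr0 mulr_ge0// sqr_ge0.
rewrite (cutoff_cone_large a0 (ltW ca)) ger0_norm; last by rewrite divr_ge0 ?sqr_ge0// ltW.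
have h : (a - c) ^+ 2 <= (a - 1) ^+ 2 by rewrite ler_pXn2r ?nnegrE//; lra.
rewrite ler_pdivrMr//; apply: (le_trans h).
have := sqr_ge0 (a - 1); nra.
Qed.

(** Small t is covered by the Taylor estimate at 1, large t by the Lipschitz
    estimate; both are uniform in the truncation c. *)
Lemma diff2_cutoff_cone b c t : `|b| <= 2 -> 0 <= c ->
  `|diff2 b (cutoff_cone c) t| <= 18 * Num.min 1 (t ^+ 2).
Proof.
move=> b2 c0; have b2' : `|- b| <= 2 by rewrite normrN.
have [t2|t2] := lerP `|t| 2^-1.
  have tt : t ^+ 2 <= 1.
    by rewrite -(real_normK (num_real t)) expr_le1//; lra.
  rewrite min_r//.
  apply: le_trans (diff2_taylor b2 t2 (fun a => @cutoff_cone_taylor c a c0) _) _ => //.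
  rewrite ler_wpM2r ?sqr_ge0// ger0_norm ?le_max ?lexx//.
  have : Num.max 0 (1 - c ^+ 2) <= 1 by rewrite ge_max ler01 gerBl sqr_ge0.
  lra.
have H1 := cutoff_cone_lip c0 (shift_norm_ge0 b t) (shift_norm_ge0 0 t).
have H2 := cutoff_cone_lip c0 (shift_norm_ge0 (- b) t) (shift_norm_ge0 0 t).
have H1' := shift_norm_sub0 t b2; have H2' := shift_norm_sub0 t b2'.
have H : `|diff2 b (cutoff_cone c) t| <= 4.
  rewrite /diff2; rewrite (_ : _ - _ = (cutoff_cone c (shift_norm b t) - cutoff_cone c (shift_norm 0 t)) +
    (cutoff_cone c (shift_norm (- b) t) - cutoff_cone c (shift_norm 0 t))); last by ring.
  by apply: le_trans (ler_normD _ _) _; lra.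
apply: le_trans H _.
have tt : 4^-1 <= t ^+ 2.
  rewrite -(real_normK (num_real t)) (_ : 4^-1 = 2^-1 ^+ 2); last by field.
  by rewrite ler_pXn2r ?nnegrE// ltW.
have : 4^-1 <= Num.min 1 (t ^+ 2) by rewrite le_min tt andbT; lra.
lra.
Qed.

End Profile.

(** * Superposing the dilates of a radial profile *)

(** Here phi is g 0 - g for a radial profile g. The hypothesis [phi_J] is the
    balance between the axis and the diagonal direction for all its dilates, and
    the section refutes it. *)
Section RadialProfile.
Context {R : realType} (s : R).
Hypothesis hs : 0 < s < 1.
Local Notation mu := (@lebesgue_measure R).
Local Notation intg f := (mu.-integrable setT (EFin \o f)).
Variables (phi : R -> R) (C0 : R).
Hypothesis phi_cont : continuous phi.
Hypothesis phi_taylor : loc_taylor phi.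
Hypothesis phi_ge0 : forall r, 0 <= phi r.
Hypothesis phi_le : forall r, phi r <= C0 * Num.min 1 (r ^+ 2).
Hypothesis phi1_gt0 : 0 < phi 1.
Hypothesis phi_J : forall r, 0 < r ->
  diff2_int s 2 (fun a => phi (r * a)) = 2 * diff2_int s (Num.sqrt 2) (fun a => phi (r * a)).

Let C0_ge0 : 0 <= C0.
Proof. by have := le_trans (phi_ge0 1) (phi_le 1); rewrite expr1n minxx mulr1. Qed.

Let phi0 : phi 0 = 0.
Proof.
apply/eqP; rewrite eq_le phi_ge0 andbT; apply: le_trans (phi_le 0) _.
by rewrite expr0n /= min_r// mulr0.
Qed.

Let measurable_phi : measurable_fun setT phi.
Proof. exact: continuous_measurable_fun. Qed.

Definition inv_sqr (r : R) : R := if 0 < r then (r ^+ 2)^-1 else 0.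

Lemma inv_sqr_ge0 r : 0 <= inv_sqr r.
Proof. by rewrite /inv_sqr; case: ifP => // _; rewrite invr_ge0 sqr_ge0. Qed.

Lemma measurable_inv_sqr : measurable_fun setT inv_sqr.
Proof.
rewrite (_ : inv_sqr = fun r => if 0 < r then r `^ (- 2%:R) else 0).
  by apply: measurable_fun_ifT => //; exact: measurable_fun_ltr.
by apply/funext => r; rewrite /inv_sqr; case: ifP => // r0; rewrite powR_invn// ltW.
Qed.

Lemma measurable_cutoff : measurable_fun setT (@cutoff R).
Proof.
apply: measurable_funX; apply: measurable_maxr => //.
exact: measurable_funB.
Qed.

(** The density of the limiting superposition: after the substitution
    rho = r a, the integral of r^(-2) phi (r a) over r is a times its mass. *)
Definition profile_density (r : R) : R := inv_sqr r * phi r.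

Let profile_density_ge0 r : 0 <= profile_density r.
Proof. by rewrite mulr_ge0// inv_sqr_ge0. Qed.

Let profile_density_npos r : r <= 0 -> profile_density r = 0.
Proof. by move=> r0; rewrite /profile_density /inv_sqr ltNge r0 mul0r. Qed.

Let measurable_profile_density : measurable_fun setT profile_density.
Proof. by apply: measurable_funM; [exact: measurable_inv_sqr|exact: measurable_phi]. Qed.

Lemma integrable_profile_density : intg profile_density.
Proof.
have pk : intg (power_kernel 0 2) by apply: integrable_power_kernel; [rewrite ltrN10|rewrite ltr1n].
apply: (@integrable_le _ _ (fun r => C0 * power_kernel 0 2 r)) => //; last first.
  exact: (integrableZl measurableT C0 pk).
move=> r; rewrite ger0_norm//; have [r0|r0] := lerP r 0.
  by rewrite profile_density_npos// mulr_ge0// power_kernel_ge0.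
rewrite /profile_density /inv_sqr r0 mulrC ler_pdivrMr ?exprn_gt0//.
apply: (le_trans (phi_le r)); rewrite -mulrA ler_wpM2l// /power_kernel gtr0_norm//.
case: ifP => r1; first by rewrite powRr0 mul1r ge_min lexx orbT.
rewrite powR_invn ?(ltW r0)// mulVf; last by rewrite gt_eqF// exprn_gt0.
by rewrite ge_min lexx.
Qed.

Definition profile_mass : R := \int[mu]_r profile_density r.

Lemma profile_mass_gt0 : 0 < profile_mass.
Proof.
have p1 := phi1_gt0.
apply: (@Rintegral_gt0 _ _ 1 (phi 1 / 8)) => //; first exact: integrable_profile_density.
  by rewrite divr_gt0.
have n1 : \forall r \near (1 : R), phi 1 / 2 <= phi r.
  by apply: (cvgr_ge _ (@phi_cont 1)); lra.
near=> r; have r0 : 0 < r by near: r; apply: lt_nbhsr; exact: ltr01.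
have r2 : r < 2 by near: r; apply: lt_nbhsl; rewrite ltr1n.
have pr : phi 1 / 2 <= phi r by near: r.
rewrite /profile_density /inv_sqr r0 [leRHS]mulrC ler_pdivlMr ?exprn_gt0//.
have : r ^+ 2 <= 2 ^+ 2 by rewrite ler_pXn2r ?nnegrE ?(ltW r0) ?(ltW r2).
nra.
Unshelve. all: by end_near. Qed.

Section Fixed.
Variable n : R.
Hypothesis n1 : 1 <= n.
Let n0 : 0 < n. Proof. exact: lt_le_trans n1. Qed.

Definition scale_avg_integrand (a r : R) : R := profile_density r * (cutoff_cone (r / n) a - cutoff_cone (r * n) a).
(** The superposition of the dilates of phi with the truncated weight
    [scale_weight], written in the variable rho = r a, where truncating the
    weight amounts to truncating cones ([scale_weight_change]). *)
Definition scale_avg (a : R) : R := \int[mu]_r scale_avg_integrand a r.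

Let cutoff_cone_le (c a : R) : 0 <= c -> 0 <= a -> `|cutoff_cone c a| <= a.
Proof. by move=> c0 a0; have := cutoff_cone_lip c0 a0 (lexx 0); rewrite cutoff_cone0 !subr0 (ger0_norm a0). Qed.

Let measurable_cutoff_cone (k a : R) : measurable_fun setT (fun r : R => cutoff_cone (r * k) a).
Proof.
rewrite /cutoff_cone; apply: measurable_funM => //.
apply: (measurableT_comp measurable_cutoff).
by apply: measurable_funM => //; exact: measurable_funM.
Qed.

Lemma scale_avg_integrand_le a r : 0 <= a -> `|scale_avg_integrand a r| <= 2 * a * profile_density r.
Proof.
move=> a0; have [r0|r0] := leP r 0; first by rewrite /scale_avg_integrand profile_density_npos// mul0r mulr0 normr0.
rewrite /scale_avg_integrand normrM (ger0_norm (profile_density_ge0 r)) mulrC ler_wpM2r//.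
apply: (le_trans (ler_normB _ _)).
have := @cutoff_cone_le (r / n) a (divr_ge0 (ltW r0) (ltW n0)) a0.
have := @cutoff_cone_le (r * n) a (mulr_ge0 (ltW r0) (ltW n0)) a0; lra.
Qed.

Lemma integrable_scale_avg a : 0 <= a -> intg (scale_avg_integrand a).
Proof.
move=> a0; apply: (@integrable_le _ _ (fun r => 2 * a * profile_density r)).
- apply: measurable_funM => //; apply: measurable_funB; exact: measurable_cutoff_cone.
- by move=> r; exact: scale_avg_integrand_le.
- exact: (integrableZl measurableT (2 * a) integrable_profile_density).
Qed.

Lemma scale_avg_lip a a' : 0 <= a -> 0 <= a' -> `|scale_avg a - scale_avg a'| <= 2 * profile_mass * `|a - a'|.
Proof.
move=> a0 a'0; have i1 := integrable_scale_avg a0; have i2 := integrable_scale_avg a'0.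
have i3 := integrableB measurableT i1 i2.
have ip := integrable_profile_density.
rewrite /scale_avg -RintegralB//; apply: (le_trans (le_normr_Rintegral _ i3)) => //.
rewrite (_ : 2 * profile_mass * _ = 2 * `|a - a'| * profile_mass); last by ring.
rewrite /profile_mass -RintegralZl//; apply: le_Rint.
- exact: (integrable_norm i3).
- exact: (integrableZl measurableT (2 * `|a - a'|) ip).
move=> r; have [r0|r0] := leP r 0.
  by rewrite /scale_avg_integrand profile_density_npos// !mul0r subrr normr0 mulr0.
rewrite /scale_avg_integrand -mulrBr normrM (ger0_norm (profile_density_ge0 r)) mulrC ler_wpM2r//.
have := cutoff_cone_lip (divr_ge0 (ltW r0) (ltW n0)) a0 a'0.
have := cutoff_cone_lip (mulr_ge0 (ltW r0) (ltW n0)) a0 a'0.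
move=> h1 h2; rewrite (_ : cutoff_cone (r / n) a - cutoff_cone (r * n) a -
  (cutoff_cone (r / n) a' - cutoff_cone (r * n) a') = (cutoff_cone (r / n) a - cutoff_cone (r / n) a') - (cutoff_cone (r * n) a - cutoff_cone (r * n) a')); last by ring.
by apply: (le_trans (ler_normB _ _)); lra.
Qed.

Lemma measurable_scale_avg b : measurable_fun setT (fun t => scale_avg (shift_norm b t)).
Proof.
apply: continuous_measurable_fun => t.
have m0 := profile_mass_gt0.
apply/cvgrPdist_le => e e0.
have e1 : 0 < e / (2 * profile_mass) by rewrite divr_gt0// mulr_gt0.
have /cvgrPdist_le/(_ _ e1) := @shift_norm_continuous R b t.
apply: filterS => x; rewrite ler_pdivlMr ?mulr_gt0// mulrC; apply: le_trans.
by apply: scale_avg_lip; exact: shift_norm_ge0.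
Qed.

Lemma diff2_scale_avg b t : `|b| <= 2 -> `|diff2 b scale_avg t| <= 36 * profile_mass * Num.min 1 (t ^+ 2).
Proof.
move=> b2; have i1 := integrable_scale_avg (shift_norm_ge0 b t).
have i2 := integrable_scale_avg (shift_norm_ge0 (- b) t); have i0 := integrable_scale_avg (shift_norm_ge0 0 t).
have i12 := integrableD measurableT i1 i2.
have i00 := integrableZl measurableT 2 i0.
have i := integrableB measurableT i12 i00.
have ip := integrable_profile_density.
have -> : diff2 b scale_avg t = \int[mu]_r (scale_avg_integrand (shift_norm b t) r + scale_avg_integrand (shift_norm (- b) t) r - 2 * scale_avg_integrand (shift_norm 0 t) r).
  by rewrite RintegralB// RintegralD// RintegralZl.
apply: (le_trans (le_normr_Rintegral _ i)) => //.
rewrite mulrAC /profile_mass -RintegralZl//; apply: le_Rint.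
- exact: (integrable_norm i).
- exact: (integrableZl measurableT (36 * Num.min 1 (t ^+ 2)) ip).
move=> r; have [r0|r0] := leP r 0.
  by rewrite /scale_avg_integrand profile_density_npos// !mul0r mulr0 addr0 subr0 normr0 mulr0.
have := diff2_cutoff_cone t b2 (divr_ge0 (ltW r0) (ltW n0)).
have := diff2_cutoff_cone t b2 (mulr_ge0 (ltW r0) (ltW n0)).
rewrite (_ : _ - _ = profile_density r * (diff2 b (cutoff_cone (r / n)) t - diff2 b (cutoff_cone (r * n)) t)); last first.
  by rewrite /scale_avg_integrand /diff2; ring.
move=> h1 h2; rewrite normrM (ger0_norm (profile_density_ge0 r)) mulrC ler_wpM2r//.
by apply: (le_trans (ler_normB _ _)); lra.
Qed.

(** Vanishes for r > n, and is O(1/r) at the origin because both cut-offs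
    are 1 + O(r) there. *)
Definition scale_weight (r : R) : R := inv_sqr r * (cutoff (r / n) - cutoff (r * n)).

Let measurable_scale_weight : measurable_fun setT scale_weight.
Proof.
apply: measurable_funM; first exact: measurable_inv_sqr.
by apply: measurable_funB; apply: (measurableT_comp measurable_cutoff); exact: measurable_funM.
Qed.

Lemma scale_weight_change a : 0 <= a ->
  intg (fun r => scale_weight r * phi (r * a)) /\ \int[mu]_r (scale_weight r * phi (r * a)) = scale_avg a.
Proof.
rewrite le_eqVlt => /predU1P[<-|a0].
  have -> : (fun r => scale_weight r * phi (r * 0)) = (fun _ => 0 * profile_density 0).
    by apply/funext => r; rewrite mulr0 phi0 mulr0 mul0r.
  have -> : scale_avg 0 = \int[mu]_r (0 * profile_density 0).
    by apply: eq_Rintegral => r _; rewrite /scale_avg_integrand !cutoff_cone0 subrr mulr0 mul0r.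
  split => //; rewrite mul0r; exact: integrable0.
have iv := integrable_scale_avg (ltW a0).
have an : a != 0 by rewrite gt_eqF.
have E : (fun r => scale_weight r * phi (r * a)) = (fun r => a * scale_avg_integrand a (0 + a * r)).
  apply/funext => r; rewrite add0r /scale_avg_integrand /profile_density /scale_weight /inv_sqr pmulr_rgt0//.
  case: ifPn => r0; last by rewrite !mul0r mulr0.
  rewrite /cutoff_cone (_ : a * r / n / a = r / n); last by field; rewrite an gt_eqF.
  rewrite (_ : a * r * n / a = r * n); last by field.
  by rewrite (mulrC r a); field; rewrite an gt_eqF.
have ia := @integrable_affine _ _ 0 a an iv.
rewrite E; split; first exact: (integrableZl measurableT a ia).
by rewrite RintegralZl// Rintegral_affine// gtr0_norm// mulrA mulfV// mul1r.
Qed.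

Let scale_weight_le r : 0 < r -> `|scale_weight r| <= 2 * n / r.
Proof.
move=> r0; rewrite /scale_weight /inv_sqr r0 normrM ger0_norm ?invr_ge0 ?sqr_ge0//.
have rn : 0 < r * n by rewrite mulr_gt0.
suff : `|cutoff (r / n) - cutoff (r * n)| <= 2 * (r * n).
  move=> H; rewrite [leLHS]mulrC ler_pdivrMr ?exprn_gt0//; apply: (le_trans H).
  by rewrite le_eqVlt; apply/orP; left; apply/eqP; field; rewrite gt_eqF.
have chi_ge (v : R) : 1 - 2 * v <= cutoff v.
  rewrite /cutoff; have [v1|v1] := leP 0 (1 - v); last by rewrite expr0n/=; lra.
  by rewrite sqrrB expr1n; have := sqr_ge0 v; lra.
have chi_le (v : R) : 0 <= v -> cutoff v <= 1.
  move=> v0; rewrite /cutoff expr_le1 ?le_max ?lexx// ge_max ler01; lra.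
have rn' : 0 < r / n by rewrite divr_gt0.
have := chi_ge (r * n); have := chi_le _ (ltW rn); have := chi_le _ (ltW rn').
have := chi_ge (r / n).
have : r / n <= r * n by rewrite ler_pdivrMr// -mulrA ler_peMr ?(ltW r0)// mulr_ege1.
by move=> *; rewrite ler_norml; apply/andP; split; lra.
Qed.

Let scale_weight0 r : r <= 0 \/ n <= r -> scale_weight r = 0.
Proof.
move=> [r0|nr]; first by rewrite /scale_weight /inv_sqr ltNge r0 mul0r.
have chi0 (v : R) : 1 <= v -> cutoff v = 0.
  by move=> v1; rewrite /cutoff max_l ?expr0n// subr_le0.
have h1 : 1 <= r / n by rewrite ler_pdivlMr// mul1r.
have h2 : 1 <= r * n by rewrite mulr_ege1// (le_trans n1).
by rewrite /scale_weight !chi0// subrr mulr0.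
Qed.

(** For small t use the Taylor estimate of phi, uniform for r <= n; for large t use
    phi x <= C0 min(1, x^2) <= C0 x^s. The power s is a compromise: it is integrable
    against the singular kernel at infinity, and against the weight at the
    origin. *)
Lemma diff2_phi b : `|b| <= 2 -> exists2 B, 0 <= B & forall r t : R, 0 < r -> r <= n ->
  `|diff2 b (fun a => phi (r * a)) t * singular_kernel s t| <=
    B * (r + r `^ s) * power_kernel (1 - 2 * s) (1 + s) t.
Proof.
move=> b2; have b2' : `|- b| <= 2 by rewrite normrN.
have b0 : `|0 : R| <= 2 by rewrite normr0.
have /andP[s0 s1] := hs; have n1' := n1; have n0' := n0; have C0' := C0_ge0.
have [f1 /(_ (2 * n))[C Cge0 HC]] := phi_taylor.
have phiC r : phi r <= C0.
  apply: (le_trans (phi_le r)); rewrite -[leRHS]mulr1 ler_wpM2l//.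
  by rewrite ge_min lexx.
have f1_le r : 0 < r -> r <= n -> `|f1 r| <= 2 * C0 + C.
  move=> r0 rn.
  have h1 : `|r| <= 2 * n by rewrite gtr0_norm//; lra.
  have h2 : `|r + 1| <= 2 * n by rewrite gtr0_norm; lra.
  have := HC r (r + 1) h1 h2; rewrite (_ : r + 1 - r = 1); last by ring.
  rewrite expr1n !mulr1; have := phiC r; have := phiC (r + 1); have := phi_ge0 r; have := phi_ge0 (r + 1).
  by rewrite !ler_norml => ? ? ? ? /andP[? ?]; apply/andP; split; lra.
pose B1 := 2 * (2 * C0 + C) + 4 * C * n.
have Cn : 0 <= C * n by rewrite mulr_ge0// (ltW n0').
have B10 : 0 <= B1 by rewrite /B1; lra.
pose B2 := 16 * C0 * 3 `^ s.
have B20 : 0 <= B2 by rewrite !mulr_ge0 ?powR_ge0.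
exists (B1 + B2); first by rewrite addr_ge0.
move=> r t r0 rn; rewrite normrM (ger0_norm (singular_kernel_ge0 s t)).
have [->|t0] := eqVneq t 0.
  rewrite singular_kernel0// mulr0 mulr_ge0 ?power_kernel_ge0// mulr_ge0//.
    by rewrite (addr_ge0 B10).
  by rewrite addr_ge0 ?powR_ge0// ltW.
have rs : 0 < r `^ s by rewrite powR_gt0.
have tt : 0 < `|t| by rewrite normr_gt0.
suff : `|diff2 b (fun a => phi (r * a)) t| <=
    (B1 + B2) * (r + r `^ s) * (if `|t| <= 1 then t ^+ 2 else `|t| `^ s).
  move=> H; apply: (le_trans (ler_wpM2r (singular_kernel_ge0 s t) H)).
  rewrite -[leLHS]mulrA ler_wpM2l//.
    by rewrite mulr_ge0 ?(addr_ge0 B10)// addr_ge0// ltW.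
  rewrite /power_kernel; case: ifP => t1.
    by rewrite sqr_singular_kernel.
  by rewrite /singular_kernel -powRN -powRD ?(gt_eqF tt) ?implybT//; rewrite le_eqVlt; apply/orP; left; apply/eqP; congr (_ `^ _); ring.
have [t2|t2] := leP `|t| 2^-1.
  have -> : `|t| <= 1 by lra.
  have HV a : `|a - 1| <= 2^-1 -> `|phi (r * a) - phi (r * 1) - (f1 r * r) * (a - 1)| <= (C * r ^+ 2) * (a - 1) ^+ 2.
    move=> a1; have := HC r (r * a).
    rewrite mulr1 (_ : r * a - r = r * (a - 1)); last by ring.
    rewrite exprMn !mulrA; apply.
      by rewrite gtr0_norm//; lra.
    rewrite normrM gtr0_norm//.
    have : `|a| <= 2 by rewrite -(subrK 1 a); apply: (le_trans (ler_normD _ _)); rewrite normr1; lra.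
    by move=> a2; rewrite (mulrC 2) ler_pM// ltW.
  apply: (le_trans (diff2_taylor b2 t2 HV _)); first by rewrite mulr_ge0// sqr_ge0.
  rewrite ler_wpM2r ?sqr_ge0// normrM (gtr0_norm r0).
  apply: (@le_trans _ _ (B1 * r)); last first.
    by apply: ler_pM => //; [exact: ltW|rewrite lerDl|rewrite lerDl ltW].
  have h1 := ler_wpM2r (ltW r0) (f1_le r r0 rn).
  have h2 : C * r ^+ 2 <= C * (n * r) by rewrite ler_wpM2l// expr2 ler_wpM2r// ltW.
  by rewrite /B1; lra.
have aux c : `|c| <= 2 -> phi (r * shift_norm c t) <= C0 * (3 `^ s * r `^ s * `|t| `^ s).
  move=> c2; apply: (le_trans (phi_le _)); rewrite ler_wpM2l//.
  have a3 : r * shift_norm c t <= 3 * r * `|t|.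
    rewrite (mulrC 3) -mulrA ler_wpM2l ?(ltW r0)//.
    have := shift_norm_sub1 t c2; rewrite ler_norml => /andP[? ?]; lra.
  have ra0 : 0 <= r * shift_norm c t by rewrite mulr_ge0 ?shift_norm_ge0// ltW.
  have rt0 : 0 < 3 * r * `|t| by rewrite !mulr_gt0.
  rewrite -!powRM ?mulr_ge0 ?(ltW r0)//.
  apply: (@le_trans _ _ (Num.min 1 ((3 * r * `|t|) ^+ 2))).
    by rewrite le_min !ge_min lexx/= ler_pXn2r ?nnegrE ?(ltW rt0)// a3 orbT.
  have [x1|x1] := leP (3 * r * `|t|) 1.
    rewrite ge_min; apply/orP; right.
    rewrite -powR_mulrn ?(ltW rt0)// ger_powR ?rt0//; lra.
  rewrite ge_min; apply/orP; left.
  by rewrite -[leLHS](powRr0 (3 * r * `|t|)) ler_powR// ltW.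
have H : `|diff2 b (fun a => phi (r * a)) t| <= 4 * C0 * (3 `^ s * r `^ s * `|t| `^ s).
  have := aux _ b2; have := aux _ b2'; have := aux _ b0.
  have := phi_ge0 (r * shift_norm b t); have := phi_ge0 (r * shift_norm (- b) t); have := phi_ge0 (r * shift_norm 0 t).
  rewrite /diff2; move: (_ `^ s * _) => X *.
  by rewrite ler_norml; apply/andP; split; lra.
apply: (le_trans H).
have ts : `|t| `^ s <= 4 * (if `|t| <= 1 then t ^+ 2 else `|t| `^ s).
  case: ifPn => t1; last by have := powR_ge0 `|t| s; lra.
  have -> : t ^+ 2 = `|t| ^+ 2 by rewrite real_normK// num_real.
  have : `|t| `^ s <= 1.
    by rewrite -[leRHS](powRr0 `|t|) ger_powR ?tt// ltW.
  have : 2^-1 ^+ 2 <= `|t| ^+ 2 by rewrite ler_pXn2r ?nnegrE// ltW.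
  lra.
have X0 : 0 <= (if `|t| <= 1 then t ^+ 2 else `|t| `^ s).
  by case: ifP => _; rewrite ?sqr_ge0 ?powR_ge0.
move: ts X0; move: (if _ then _ else _) => X ts X0.
apply: (@le_trans _ _ (B2 * r `^ s * X)).
  rewrite /B2 (_ : 16 * C0 * 3 `^ s * r `^ s * X = 4 * C0 * (3 `^ s * r `^ s * (4 * X))); last by ring.
  by rewrite !ler_wpM2l ?mulr_ge0 ?powR_ge0.
rewrite ler_wpM2r//; apply: ler_pM => //; [exact: ltW|by rewrite lerDr|by rewrite lerDr ltW].
Qed.

(** The cut-off at n is what bounds the integrand by a product of integrable
    functions. *)
Lemma scale_weight_Fubini b : `|b| <= 2 ->
  intg (fun r => scale_weight r * diff2_int s b (fun a => phi (r * a))) /\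
  \int[mu]_r (scale_weight r * diff2_int s b (fun a => phi (r * a))) = diff2_int s b scale_avg.
Proof.
move=> b2; have b2' : `|- b| <= 2 by rewrite normrN.
have b0 : `|0 : R| <= 2 by rewrite normr0.
have /andP[s0 s1] := hs.
have [B B0 HB] := diff2_phi b2.
pose D (r t : R) := diff2 b (fun a => phi (r * a)) t.
pose F (r t : R) := scale_weight r * (D r t * singular_kernel s t).
pose ar (r : R) := if 0 < r < n then 2 * n * B * (1 + r `^ (s - 1)) else 0.
have mphia c : measurable_fun setT (fun z : R * R => phi (z.1 * shift_norm c z.2)).
  apply: (measurableT_comp measurable_phi); apply: measurable_funM => //.
  by apply: (measurableT_comp (@measurable_shift_norm R c)).
have mF : measurable_fun setT (fun z : R * R => F z.1 z.2).
  apply: measurable_funM; first by apply: (measurableT_comp measurable_scale_weight).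
  apply: measurable_funM; last by apply: (measurableT_comp (measurable_singular_kernel s)).
  by apply: measurable_funB; [exact: measurable_funD|exact: measurable_funM].
have pk1 : intg (power_kernel 0 2) by apply: integrable_power_kernel; [rewrite ltrN10|rewrite ltr1n].
have pk2 : intg (power_kernel (s - 1) 2) by apply: integrable_power_kernel; [lra|rewrite ltr1n].
have pk3 : intg (power_kernel (1 - 2 * s) (1 + s)) by apply: integrable_power_kernel; lra.
have ai : intg ar.
  apply: (@integrable_le _ _ (fun r => 2 * n * B * n ^+ 2 * (power_kernel 0 2 r + power_kernel (s - 1) 2 r))).
  - apply: measurable_fun_ifT => //.
      by apply: measurable_and; exact: measurable_fun_ltr.
    apply: measurable_funM => //; apply: measurable_funD => //; exact: measurable_powR.
  - move=> r; rewrite /ar; case: ifPn => [/andP[r0 rn]|_]; last first.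
      by rewrite normr0 !mulr_ge0 ?addr_ge0 ?power_kernel_ge0 ?sqr_ge0// (ltW n0).
    have nB : 0 <= 2 * n * B by rewrite !mulr_ge0// (ltW n0).
    rewrite ger0_norm; last by rewrite mulr_ge0// addr_ge0// powR_ge0.
    rewrite -[leRHS]mulrA ler_wpM2l//.
    have n2 : 1 <= n ^+ 2 by rewrite expr_ge1 ?(ltW n0).
    rewrite /power_kernel gtr0_norm//; case: ifPn => [r1|].
      by rewrite powRr0 ler_peMl// addr_ge0 ?powR_ge0.
    rewrite -ltNge => r1; rewrite powR_invn ?(ltW r0)//.
    have r2 : 1 <= n ^+ 2 * r ^- 2.
      by rewrite ler_pdivlMr ?exprn_gt0// mul1r ler_pXn2r ?nnegrE ?(ltW r0) ?(ltW n0)// ltW.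
    have : r `^ (s - 1) <= 1 by rewrite -[leRHS](powRr0 r) ler_powR ?(ltW r1)//; lra.
    by rewrite mulrDr; lra.
  - exact: (integrableZl measurableT _ (integrableD measurableT pk1 pk2)).
have FB r t : `|F r t| <= ar r * power_kernel (1 - 2 * s) (1 + s) t.
  rewrite /ar; case: ifPn => [/andP[r0 rn]|H]; last first.
    rewrite /F scale_weight0 ?mul0r ?normr0//; move: H; rewrite negb_and -!leNgt => /orP[] ?; by [left|right].
  rewrite /F normrM; have := ler_pM (normr_ge0 _) (normr_ge0 _) (scale_weight_le r0) (HB r t r0 (ltW rn)).
  move/le_trans; apply; rewrite !mulrA ler_wpM2r ?power_kernel_ge0//.
  rewrite powRB ?(gt_eqF r0) ?implybT// powRr1 ?(ltW r0)//.
  by rewrite le_eqVlt; apply/orP; left; apply/eqP; field; rewrite gt_eqF.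
have [iF fub] := Rintegral_Fubini mF ai pk3 FB.
have -> : (fun r => scale_weight r * diff2_int s b (fun a => phi (r * a))) = (fun r => \int[mu]_t F r t).
  apply/funext => r; rewrite /diff2_int.
  have [w0|w0] := eqVneq (scale_weight r) 0.
    rewrite w0 mul0r; under eq_Rintegral do rewrite /F w0 mul0r.
    by rewrite /Rintegral integral0.
  have Fi : intg (F r).
    apply: (integrable_le _ (FB r)); last exact: (integrableZl measurableT (ar r) pk3).
    exact: (measurableT_comp mF (measurable_pair1 r)).
  have Gi : intg (fun t => D r t * singular_kernel s t).
    rewrite (_ : (fun t => _) = (fun t => (scale_weight r)^-1 * F r t)).
      exact: (integrableZl measurableT (scale_weight r)^-1 Fi).
    by apply/funext => t; rewrite /F mulKf.
  exact: (esym (RintegralZl (scale_weight r) measurableT Gi)).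
split; first exact: iF.
rewrite fub; apply: eq_Rintegral => t _.
have [i1 e1] := scale_weight_change (shift_norm_ge0 b t).
have [i2 e2] := scale_weight_change (shift_norm_ge0 (- b) t).
have [i3 e3] := scale_weight_change (shift_norm_ge0 0 t).
pose A (r : R) := scale_weight r * phi (r * shift_norm b t).
pose A' (r : R) := scale_weight r * phi (r * shift_norm (- b) t).
pose A0 (r : R) := scale_weight r * phi (r * shift_norm 0 t).
have i12 : intg (fun r => A r + A' r) := integrableRD i1 i2.
have i4 : intg (fun r => 2 * A0 r) := integrableRZ 2 i3.
pose S (r : R) := A r + A' r - 2 * A0 r.
have i : intg S := integrableRB i12 i4.
have -> : diff2 b scale_avg t = \int[mu]_r S r.
  rewrite /diff2 -e1 -e2 -e3 -/A -/A' -/A0.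
  by rewrite /S (RintegralB measurableT i12 i4) (RintegralD measurableT i1 i2) (RintegralZl 2 measurableT i3).
transitivity (\int[mu]_r (S r * singular_kernel s t)).
  by apply: eq_Rintegral => r _; rewrite /F /D /S /A /A' /A0 /diff2; ring.
exact: (RintegralZr (singular_kernel s t) measurableT i).
Qed.

End Fixed.

Let m0 := profile_mass_gt0.

Lemma scale_avg_cvg a : 0 <= a -> scale_avg n.+1%:R a @[n --> \oo] --> profile_mass * a.
Proof.
move=> a0.
have ip := integrable_profile_density.
have iz := integrableZl measurableT (2 * a) ip.
have n1 (n : nat) : 1 <= n.+1%:R :> R by rewrite ler1n.
have -> : profile_mass * a = \int[mu]_r (a * profile_density r) by rewrite RintegralZl// mulrC.
have [] // := @dominated_cvg_Rintegral R (fun n => scale_avg_integrand n.+1%:R a) (fun r => a * profile_density r)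
  (fun r => 2 * a * profile_density r).
- by move=> n; exact: (integrable_measurable (integrable_scale_avg (n1 n) a0)).
- exact: (integrable_measurable (integrableZl measurableT a ip)).
- move=> r; have [r0|r0] := leP r 0.
    rewrite (_ : (fun n => _) = (fun _ => 0)).
      by rewrite profile_density_npos// mulr0; exact: cvg_cst.
    by apply/funext => n; rewrite /scale_avg_integrand profile_density_npos// mul0r.
  rewrite mulrC; apply: cvgMl_tmp.
  apply/cvgrPdist_le => e e0.
  pose K := (Num.truncn (Num.max (2 * r / e) (a / r))).+1.
  exists K => // n /= Kn.
  have : Num.max (2 * r / e) (a / r) < n.+1%:R.
    by apply: (lt_le_trans (truncnS_gt _)); rewrite ler_nat (leq_trans Kn).
  rewrite gt_max !ltr_pdivrMr// => /andP[h1 h2].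
  have h3 : a <= r * n.+1%:R by rewrite mulrC ltW.
  rewrite (cutoff_cone_small a0 h3) subr0.
  have rn : 0 <= r / n.+1%:R by rewrite divr_ge0// ltW.
  apply: (le_trans (cutoff_cone_near rn a0)).
  by rewrite mulrA ler_pdivrMr// [leRHS]mulrC ltW.
- by move=> n r; exact: (scale_avg_integrand_le (n1 n)).
Qed.

Lemma diff2_scale_avg_cvg b t : diff2 b (scale_avg n.+1%:R) t @[n --> \oo] --> profile_mass * diff2 b id t.
Proof.
rewrite /diff2 mulrBr mulrDr (mulrCA profile_mass 2).
apply: cvgB; first by apply: cvgD; apply: scale_avg_cvg; exact: shift_norm_ge0.
by apply: cvgMl_tmp; apply: scale_avg_cvg; exact: shift_norm_ge0.
Qed.

Lemma integrable_diff2_id b : `|b| <= 2 -> intg (fun t => diff2 b id t * singular_kernel s t).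
Proof.
move=> b2; have b2' : `|- b| <= 2 by rewrite normrN.
apply: (@integrable_singular_kernel _ _ hs _ 4).
  have ma c := @measurable_shift_norm R c.
  apply: measurable_funB; first exact: (measurable_funD (ma b) (ma (- b))).
  exact: (measurable_funM (measurable_cst _) (ma 0)).
move=> t; have [t1|t1] := leP `|t| 1.
  rewrite min_r; last by rewrite -(real_normK (num_real t)) expr_le1//.
  apply: (le_trans (diff2_id_le t b2)); rewrite ler_wpM2r ?sqr_ge0//; lra.
rewrite min_l ?mulr1; last by rewrite -(real_normK (num_real t)) expr_ge1// ltW.
have H1 := shift_norm_sub0 t b2; have H2 := shift_norm_sub0 t b2'.
rewrite /diff2 /= (_ : _ - _ = (shift_norm b t - shift_norm 0 t) + (shift_norm (- b) t - shift_norm 0 t)); last by ring.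
by apply: le_trans (ler_normD _ _) _; lra.
Qed.

Lemma diff2_int_cvg b : `|b| <= 2 -> diff2_int s b (scale_avg n.+1%:R) @[n --> \oo] --> profile_mass * diff2_int s b id.
Proof.
move=> b2; have id2 := integrable_diff2_id b2.
have n1 (n : nat) : 1 <= n.+1%:R :> R by rewrite ler1n.
have mmin : measurable_fun setT (fun t : R => Num.min 1 (t ^+ 2)).
  by apply: measurable_minr => //; exact: measurable_funX.
have imin : intg (fun t => (36 * profile_mass * Num.min 1 (t ^+ 2)) * singular_kernel s t).
  apply: (@integrable_singular_kernel _ _ hs _ (36 * profile_mass)); first exact: measurable_funM.
  have min0 (t : R) : 0 <= Num.min 1 (t ^+ 2) by rewrite le_min ler01 sqr_ge0.
  move=> t; rewrite ger0_norm//; apply: mulr_ge0 => //.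
  by apply: mulr_ge0 => //; exact: ltW.
have -> : profile_mass * diff2_int s b id = \int[mu]_t (profile_mass * (diff2 b id t * singular_kernel s t)).
  by rewrite (RintegralZl profile_mass measurableT id2).
have mz := integrableRZ profile_mass id2.
have [] // := @dominated_cvg_Rintegral R (fun n t => diff2 b (scale_avg n.+1%:R) t * singular_kernel s t)
  (fun t => profile_mass * (diff2 b id t * singular_kernel s t))
  (fun t => (36 * profile_mass * Num.min 1 (t ^+ 2)) * singular_kernel s t).
- move=> n; apply: measurable_funM; last exact: measurable_singular_kernel.
  have mV c := measurable_scale_avg (n1 n) c.
  by apply: measurable_funB; [exact: measurable_funD|exact: measurable_funM].
- exact: (integrable_measurable mz).
- move=> t; rewrite mulrA; apply: cvgMr_tmp; exact: diff2_scale_avg_cvg.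
- move=> n t; rewrite normrM (ger0_norm (singular_kernel_ge0 s t)) ler_wpM2r ?singular_kernel_ge0//.
  exact: diff2_scale_avg.
Qed.

Lemma radial_profile_contradiction : False.
Proof.
have r2 : Num.sqrt 2 ^+ 2 = 2 :> R by rewrite sqr_sqrtr.
have r0 : 0 <= Num.sqrt 2 :> R by exact: sqrtr_ge0.
have b1 : `|Num.sqrt 2 : R| <= 2 by rewrite ger0_norm//; nra.
have b2 : `|2 : R| <= 2 by rewrite ger0_norm.
have n1 (n : nat) : 1 <= n.+1%:R :> R by rewrite ler1n.
have J2 n : diff2_int s 2 (scale_avg n.+1%:R) = 2 * diff2_int s (Num.sqrt 2) (scale_avg n.+1%:R).
  have [_ <-] := scale_weight_Fubini (n1 n) b2; have [i1 <-] := scale_weight_Fubini (n1 n) b1.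
  rewrite -(RintegralZl 2 measurableT i1); apply: eq_Rintegral => r _.
  have [r0'|r0'] := leP r 0; first by rewrite /scale_weight /inv_sqr ltNge r0' !mul0r mulr0.
  by rewrite phi_J//; ring.
have c1 := diff2_int_cvg b2; have c2 := diff2_int_cvg b1.
have E : profile_mass * diff2_int s 2 id = 2 * (profile_mass * diff2_int s (Num.sqrt 2) id).
  have e12 : (fun n : nat => diff2_int s 2 (scale_avg n.+1%:R)) =
      (fun n : nat => 2 * diff2_int s (Num.sqrt 2) (scale_avg n.+1%:R)).
    by apply/funext => n; rewrite J2.
  have c1' : 2 * diff2_int s (Num.sqrt 2) (scale_avg n.+1%:R) @[n --> \oo] --> profile_mass * diff2_int s 2 id.
    by rewrite -e12.
  have c2' : 2 * diff2_int s (Num.sqrt 2) (scale_avg n.+1%:R) @[n --> \oo] -->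
      2 * (profile_mass * diff2_int s (Num.sqrt 2) id) by exact: cvgMl_tmp.
  exact: (cvg_unique _ c1' c2').
have i2 := integrable_diff2_id b2; have i1 := integrable_diff2_id b1.
have : 0 < \int[mu]_t (2 * (diff2 (Num.sqrt 2) id t * singular_kernel s t) - diff2 2 id t * singular_kernel s t).
  pose G (t : R) := (2 * diff2 (Num.sqrt 2) id t - diff2 2 id t) * singular_kernel s t.
  have GE : (fun t => 2 * (diff2 (Num.sqrt 2) id t * singular_kernel s t) - diff2 2 id t * singular_kernel s t) = G.
    by apply/funext => t; rewrite /G; ring.
  have G1 : 0 < G 1.
    have n10 : (1 : R) != 0 by rewrite oner_eq0.
    by rewrite mulr_gt0 ?singular_kernel_gt0//; have := diff2_id_lt n10; lra.
  have Gi := integrableRB (integrableRZ 2 i1) i2; rewrite GE in Gi *.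
  apply: (@Rintegral_gt0 _ _ 1 (G 1 / 2)) => //.
  - move=> t; have [->|t0] := eqVneq t 0; first by rewrite /G singular_kernel0// mulr0.
    by rewrite mulr_ge0 ?singular_kernel_ge0//; have := diff2_id_lt t0; lra.
  - by rewrite divr_gt0.
  - have k2 : {for (1 : R), continuous (fun _ : R => 2 : R)} by exact: cst_continuous.
    have cG : {for 1, continuous G}.
      have ca c : {for (1 : R), continuous (fun t : R => shift_norm c t)} by exact: shift_norm_continuous.
      have c20 : {for (1 : R), continuous (fun t : R => 2 * shift_norm 0 t : R)} := continuousM k2 (ca 0).
      have cd b : {for (1 : R), continuous (fun t : R => diff2 b id t)} :=
        continuousB (continuousD (ca b) (ca (- b))) c20.
      have c2' : {for (1 : R), continuous (fun t : R => 2 * diff2 (Num.sqrt 2) id t : R)} :=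
        continuousM k2 (cd _).
      have cs : {for (1 : R), continuous (singular_kernel s)} by apply: singular_kernel_continuous; rewrite // oner_eq0.
      exact: (continuousM (continuousB c2' (cd 2)) cs).
    by apply: (cvgr_ge _ cG); lra.
have i1' := integrableRZ 2 i1.
rewrite (RintegralB measurableT i1' i2) (RintegralZl 2 measurableT i1) -/(diff2_int s 2 id) -/(diff2_int s (Num.sqrt 2) id).
have : profile_mass * (2 * diff2_int s (Num.sqrt 2) id - diff2_int s 2 id) = 0 by rewrite mulrBr E; ring.
move/eqP; rewrite mulf_eq0 (gt_eqF m0)/= => /eqP ->.
by rewrite ltxx.
Qed.

End RadialProfile.

(** * Moving planes and the failure of radial symmetry *)

Section Solution.
Context {R : realType} {N : nat} (s p : R) (u : 'rV[R]_N -> R).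
Hypothesis hN : (2 <= N)%N.
Hypothesis hs : 0 < s < 1.
Hypothesis hp : N%:R / (N%:R - 2 * s) < p.
Hypothesis hC2 : Ck 2 u.
Hypothesis hpos : forall x, 0 < u x.
Hypothesis heq : forall x, - frac_op s u x = u x `^ p.
Hypothesis hdecay : u =o_ at_infinity (fun x => enorm x `^ (- (2 * s / (p - 1)))).

(** N >= 2 > 2s makes the critical exponent exceed 1. *)
Lemma exponent_gt1 : 1 < p.
Proof.
have := hs => /andP[s0 s1].
have N2 : 2 <= N%:R :> R by rewrite (ler_nat R 2).
apply: le_lt_trans hp; rewrite ler_pdivlMr; lra.
Qed.

Lemma solution_continuous : continuous u.
Proof. by have [] := hC2. Qed.

Lemma solution_decay (e : R) : 0 < e -> exists2 M, 1 <= M &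
  forall x, M < enorm x -> u x <= e * enorm x `^ (- (2 * s / (p - 1))).
Proof.
move=> e0; move/eqoP : hdecay => /(_ _ e0) [M HM].
exists (Num.max 1 M); first by rewrite le_max lexx.
move=> x; rewrite gt_max => /andP[_ /HM].
by rewrite gtr0_norm// ger0_norm// powR_ge0.
Qed.

Lemma solution_cvg0 (e : R) : 0 < e -> exists2 M, 1 <= M &
  forall x, M < enorm x -> u x <= e.
Proof.
move=> e0; have [M M1 HM] := solution_decay e0; exists M => // x Mx.
have p1 := exponent_gt1; have /andP[s0 s1] := hs.
apply: le_trans (HM x Mx) _; rewrite -[leRHS]mulr1 ler_wpM2l ?(ltW e0)//.
rewrite -[leRHS](powRr0 (enorm x)) ler_powR//; first by rewrite (le_trans M1)// ltW.
by rewrite oppr_le0 divr_ge0//; lra.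
Qed.

Lemma solution_bounded : exists2 U, 0 < U & forall x, u x <= U.
Proof.
have [M M1 HM] := solution_cvg0 ltr01.
have K0 : [set x : 'rV[R]_N | enorm x <= M /\ setT x] !=set0.
  exists 0; split => //; rewrite /enorm big1 ?sqrtr0 ?(le_trans ler01)// => i _.
  by rewrite mxE expr0n.
have [c _ cM] := @EVT_max_rV _ _ u _ K0 (@compact_enorm_le R N M _ closedT)
  (continuous_subspaceT solution_continuous).
exists (Num.max 1 (u c)); first by rewrite lt_max ltr01.
move=> x; rewrite le_max; have [xM|/HM ->//] := leP (enorm x) M.
by rewrite cM ?orbT// inE.
Qed.

Lemma is_derive_line (v : 'rV[R]_N -> R) (x e : 'rV[R]_N) : (forall y, derivable v y e) ->
  forall t : R, is_derive t (1:R) (fun t => v (x + t *: e)) ('D_e v (x + t *: e)).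
Proof.
move=> dv t.
have E : (fun h : R => h^-1 *: ((fun t => v (x + t *: e)) (h *: (1 : R) + t) - v (x + t *: e)))
       = (fun h => h^-1 *: (v (h *: e + (x + t *: e)) - v (x + t *: e))).
  apply/funext => h; congr (_ *: (v _ - _)).
  by rewrite (_ : h *: (1 : R) = h); [rewrite scalerDl addrCA|exact: mulr1].
by apply: DeriveDef; rewrite /derivable /derive /= E//; exact: dv.
Qed.

Definition line (x : 'rV[R]_N) (j : 'I_N) (t : R) := u (x + t *: ebasis R j).

Lemma line_taylor x j : loc_taylor (line x j).
Proof.
have [_ /(_ j)[d1 [_ /(_ j)[d2 [c2 _]]]]] := hC2.
apply: (loc_taylor_C2 (is_derive_line x d1) (is_derive_line x d2)).
by move=> t; exact: (continuous_comp (@line_continuous R N x j t) (c2 _)).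
Qed.

Lemma line_tame x j : tame (line x j).
Proof.
have [U U0 uU] := solution_bounded; split.
- by move=> t; exact: (continuous_comp (@line_continuous R N x j t) (@solution_continuous _)).
- by exists U => t; rewrite ger0_norm ?uU// ltW// hpos.
- have [f1 /(_ 1)[C C0 HC]] := line_taylor x j; exists (2 * C) => t t1.
  have := HC 0 t; have := HC 0 (- t); rewrite normrN normr0 !subr0 sqrrN.
  move=> /(_ ler01 t1) + /(_ ler01 t1); rewrite !ler_norml => /andP[a1 a2] /andP[b1 b2].
  by apply/andP; split; lra.
Qed.

Lemma frac_opE x : frac_op s u x = Cs s / 2 * \sum_(j < N) frac1 s (line x j).
Proof.
rewrite /frac_op mulr_sumr; apply: eq_bigr => j _; congr (_ * _).
apply: eq_Rintegral => t _.
by rewrite /line scale0r addr0 scaleNr.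
Qed.

(** The equation forces the constant to be nonzero: otherwise its left-hand side
    would vanish while u^p is positive. *)
Lemma Cs_gt0 : 0 < Cs s.
Proof.
have := heq 0; have Cs0 : 0 <= Cs s.
  rewrite invr_ge0; apply: Rintegral_ge0 => x _.
  by rewrite divr_ge0 ?powR_ge0// subr_ge0 cos_le1.
rewrite frac_opE lt_neqAle Cs0 andbT => E; apply/eqP => Cs00.
have := powR_gt0 p (hpos 0).
by rewrite -E -Cs00 !mul0r oppr0 ltxx.
Qed.

Section Mirrored.
Variables (i : 'I_N) (l : R).

Definition wdiff (x : 'rV[R]_N) := u (mirror i l x) - u x.
Definition wline (x : 'rV[R]_N) j (t : R) := wdiff (x + t *: ebasis R j).

Lemma wline_tame_frac1 x j : tame (wline x j) /\
  frac1 s (wline x j) = frac1 s (line (mirror i l x) j) - frac1 s (line x j).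
Proof.
have [-> {j}|ji] := eqVneq j i.
  have -> : wline x i = (fun t => (fun t => line (mirror i l x) i (- t)) t - line x i t).
    by apply/funext => t; rewrite /wline /wdiff mirror_linei.
  have t1 := tameN (line_tame (mirror i l x) i); have t2 := line_tame x i.
  by split; [exact: tameB|rewrite frac1B// frac1N].
have -> : wline x j = (fun t => line (mirror i l x) j t - line x j t).
  by apply/funext => t; rewrite /wline /wdiff mirror_line.
have t1 := line_tame (mirror i l x) j; have t2 := line_tame x j.
by split; [exact: tameB|rewrite frac1B].
Qed.

Lemma wdiff_eq x :
  Cs s / 2 * \sum_(j < N) frac1 s (wline x j) = u x `^ p - u (mirror i l x) `^ p.
Proof.
have -> : \sum_(j < N) frac1 s (wline x j) =
    \sum_(j < N) frac1 s (line (mirror i l x) j) - \sum_(j < N) frac1 s (line x j).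
  by rewrite -sumrB; apply: eq_bigr => j _; have [] := wline_tame_frac1 x j.
by rewrite mulrBr -!frac_opE -!heq; ring.
Qed.

Lemma wline0 x j : wline x j 0 = wdiff x.
Proof. by rewrite /wline scale0r addr0. Qed.

Lemma wdiff_mirror x : wdiff (mirror i l x) = - wdiff x.
Proof. by rewrite /wdiff mirrorK opprB. Qed.

Lemma wline_antisym x t : wline x i (2 * (l - x 0 i) - t) = - wline x i t.
Proof. by rewrite /wline mirror_line_refl wdiff_mirror. Qed.

Lemma wdiff_continuous : continuous wdiff.
Proof.
move=> x; apply: continuousB; last exact: solution_continuous.
exact: (continuous_comp (@mirror_continuous R N i l x) (@solution_continuous _)).
Qed.

Definition half_space_min (x : 'rV[R]_N) :=
  x 0 i < l /\ forall y : 'rV[R]_N, y 0 i < l -> wdiff x <= wdiff y.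

Lemma half_space_min_line x j : half_space_min x -> j != i -> forall t, wline x j 0 <= wline x j t.
Proof.
by move=> [xl xmin] ji t; rewrite wline0; apply: xmin; rewrite line_coord (negbTE ji) mul0r addr0.
Qed.

Lemma half_space_min_linei x : half_space_min x ->
  forall t, t < l - x 0 i -> wline x i 0 <= wline x i t.
Proof.
by move=> [xl xmin] t tl; rewrite wline0; apply: xmin; rewrite line_coord eqxx mul1r; lra.
Qed.

(** Since u is positive, w >= - u, so w is nearly nonnegative far away and the
    minimum is taken over a compact set; it is off the plane because w vanishes
    there. *)
Lemma negative_minimum_exists (y : 'rV[R]_N) : y 0 i < l -> wdiff y < 0 ->
  exists2 x, half_space_min x & wdiff x < 0.
Proof.
move=> yl wy; have e0 : 0 < - wdiff y / 2 by lra.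
have [M _ HM] := solution_cvg0 e0.
pose M' := Num.max M (enorm y).
pose A : set 'rV[R]_N := [set x | x 0 i <= l].
have cA : closed A.
  apply: (@closed_comp _ _ (fun x : 'rV[R]_N => x 0 i) [set t | t <= l]); last exact: closed_le.
  by move=> x _; exact: coord_continuous.
have K0 : [set x : 'rV[R]_N | enorm x <= M' /\ A x] !=set0.
  by exists y; split; [rewrite /M' le_max lexx orbT|exact: ltW].
have [c cK cmin] := @EVT_min_rV _ _ wdiff _ K0 (@compact_enorm_le R N M' _ cA)
  (continuous_subspaceT wdiff_continuous).
have wcy : wdiff c <= wdiff y.
  by apply: cmin; rewrite inE; split; [rewrite /M' le_max lexx orbT|exact: ltW].
have wc0 : wdiff c < 0 by apply: le_lt_trans wy.
exists c => //; move: cK; rewrite inE => -[_ cl]; split.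
  rewrite lt_neqAle cl andbT; apply/eqP => cl'.
  by move: wc0; rewrite /wdiff mirror_fix// subrr ltxx.
move=> z zl; have [zM|zM] := leP (enorm z) M'.
  by apply: cmin; rewrite inE; split => //; exact: ltW.
apply: (le_trans wcy).
have : u z <= - wdiff y / 2 by apply: HM; apply: le_lt_trans zM; rewrite /M' le_max lexx.
have := hpos (mirror i l z); have -> : wdiff z = u (mirror i l z) - u z by []; lra.
Qed.

End Mirrored.

Lemma powR_slope (a b : R) : 0 < a -> a <= b -> b `^ p - a `^ p <= p * b `^ (p - 1) * (b - a).
Proof.
move=> a0; have p1 := exponent_gt1; rewrite le_eqVlt => /predU1P[->|ab].
  by rewrite !subrr mulr0.
have d x : x \in `]a, b[ -> is_derive x 1 (@powR R ^~ p) (p * x `^ (p - 1)).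
  by rewrite in_itv/= => /andP[ax _]; apply: is_derive1_powR; exact: lt_trans ax.
have [|c] := @MVT _ _ _ a b ab d.
  apply: derivable_within_continuous => x; rewrite in_itv/= => /andP[ax _].
  by apply: derivable_powR; rewrite in_itv/= andbT (lt_le_trans a0).
rewrite in_itv/= => /andP[ac cb] ->.
rewrite ler_wpM2r ?subr_ge0 ?(ltW ab)// ler_wpM2l//; first by lra.
by apply: ge0_ler_powR; rewrite ?nnegrE; lra.
Qed.

(** At a negative minimum the lines parallel to the plane contribute a
    nonnegative amount, the line across the plane at least a multiple of
    - w d^(-2s), and the equation bounds the total by - w p u^(p-1). *)
Lemma negative_minimum_estimate : exists2 k, 0 < k & forall i l (x : 'rV[R]_N),
  half_space_min i l x -> wdiff i l x < 0 ->
  k <= (2 * (l - x 0 i)) `^ (2 * s) * u x `^ (p - 1).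
Proof.
have C0 := Cs_gt0; have p1 := exponent_gt1; have /andP[s0 s1] := hs.
exists (Cs s / 8 / p); first by rewrite !divr_gt0//; lra.
move=> i l x xm wx; have xl : x 0 i < l by case: xm.
pose d := l - x 0 i; have d0 : 0 < d by rewrite subr_gt0.
have [twi _] := wline_tame_frac1 i l x i.
have oddi := @frac1_antisym_ge R s hs (wline i l x i) d d0 twi (wline_antisym i l x)
  (half_space_min_linei xm).
have {oddi} Hi : - wdiff i l x * singular_kernel s (2 * d) * (d / 2) <= frac1 s (wline i l x i).
  by move: oddi; rewrite wline0; apply; exact: ltW.
have Hs : frac1 s (wline i l x i) <= \sum_(j < N) frac1 s (wline i l x j).
  rewrite (bigD1 i isT) /= lerDl; apply: sumr_ge0 => j ji.
  by apply: frac1_min_ge0; exact: half_space_min_line.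
have uu : u (mirror i l x) <= u x by move: wx; rewrite /wdiff; lra.
have Hu := powR_slope (hpos (mirror i l x)) uu.
have E := wdiff_eq i l x.
have w0 : 0 < - wdiff i l x by rewrite oppr_gt0.
have Hp : Cs s / 2 * (singular_kernel s (2 * d) * (d / 2)) <= p * u x `^ (p - 1).
  rewrite -(ler_pM2l w0).
  have -> : - wdiff i l x * (p * u x `^ (p - 1)) = p * u x `^ (p - 1) * (u x - u (mirror i l x)).
    by rewrite /wdiff; ring.
  apply: le_trans Hu; rewrite -E.
  rewrite (_ : - wdiff i l x * _ = Cs s / 2 * (- wdiff i l x * singular_kernel s (2 * d) * (d / 2))); last by ring.
  by rewrite ler_wpM2l; [|lra|exact: le_trans Hs].
have d20 : 0 < 2 * d by lra.
have Ek : singular_kernel s (2 * d) * (2 * d) * (2 * d) `^ (2 * s) = 1.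
  rewrite /singular_kernel gtr0_norm// -mulrA -{2}(powRr1 (ltW d20)) -powRD.
    by rewrite mulVf// gt_eqF// powR_gt0.
  by rewrite (gt_eqF d20) implybT.
have := ler_wpM2r (powR_ge0 (2 * d) (2 * s)) Hp.
have -> : Cs s / 2 * (singular_kernel s (2 * d) * (d / 2)) * (2 * d) `^ (2 * s)
    = Cs s / 8 * (singular_kernel s (2 * d) * (2 * d) * (2 * d) `^ (2 * s)) by field.
rewrite Ek mulr1 => H; rewrite ler_pdivrMr; last by lra.
by apply: (le_trans H); rewrite le_eqVlt; apply/orP; left; apply/eqP; rewrite /d; ring.
Qed.

Lemma negative_minimum_distance : exists2 d, 0 < d & forall i l (x : 'rV[R]_N),
  half_space_min i l x -> wdiff i l x < 0 -> x 0 i <= l - d.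
Proof.
have [k k0 Hk] := negative_minimum_estimate.
have [U U0 HU] := solution_bounded.
have p1 := exponent_gt1; have /andP[s0 s1] := hs.
pose q := k / U `^ (p - 1); have q0 : 0 < q by rewrite divr_gt0// powR_gt0.
exists (q `^ (2 * s)^-1 / 2); first by rewrite divr_gt0// powR_gt0.
move=> i l x xm wx; have xl : x 0 i < l by case: xm.
rewrite leNgt; apply/negP => H.
have := Hk i l x xm wx; apply/negP; rewrite -ltNge.
apply: (@le_lt_trans _ _ ((2 * (l - x 0 i)) `^ (2 * s) * U `^ (p - 1))).
  rewrite ler_wpM2l ?powR_ge0//; apply: ge0_ler_powR; rewrite ?nnegrE ?HU ?ltW//; lra.
rewrite -ltr_pdivlMr ?powR_gt0// -/q.
have -> : q = (q `^ (2 * s)^-1) `^ (2 * s).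
  by rewrite -powRrM mulVf ?powRr1// ?ltW// gt_eqF//; lra.
apply: gt0_ltr_powR; rewrite ?nnegrE ?powR_ge0//; lra.
Qed.

(** Far out, d is comparable to the norm of x as soon as that norm exceeds |l|, and
    the decay of u contradicts the estimate. *)
Lemma negative_minimum_near : exists M, forall i l (x : 'rV[R]_N),
  half_space_min i l x -> wdiff i l x < 0 -> enorm x <= Num.max M `|l|.
Proof.
have [k k0 Hk] := negative_minimum_estimate.
have p1 := exponent_gt1; have /andP[s0 s1] := hs.
pose q := k / 4 `^ (2 * s) / 2; have q0 : 0 < q by rewrite !divr_gt0// powR_gt0.
have [M M1 HM] := solution_decay (powR_gt0 (p - 1)^-1 q0).
exists M => i l x xm wx; have xl : x 0 i < l by case: xm.
rewrite leNgt gt_max; apply/negP => /andP[Mx lx].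
have x0 : 0 < enorm x by apply: lt_trans Mx; lra.
have := Hk i l x xm wx; apply/negP; rewrite -ltNge.
have H1 : (2 * (l - x 0 i)) `^ (2 * s) <= 4 `^ (2 * s) * enorm x `^ (2 * s).
  have x0' := ltW x0; rewrite -powRM//; apply: ge0_ler_powR; rewrite ?nnegrE; try lra.
  have := coord_le_enorm x i; rewrite ler_norml => /andP[? ?].
  have := ler_norm l; lra.
have H2 : u x `^ (p - 1) <= q * enorm x `^ (- (2 * s)).
  apply: (@le_trans _ _ ((q `^ (p - 1)^-1 * enorm x `^ (- (2 * s / (p - 1)))) `^ (p - 1))).
    apply: ge0_ler_powR; rewrite ?nnegrE ?mulr_ge0 ?powR_ge0 ?HM ?(ltW (hpos x))//; lra.
  have pn : p - 1 != 0 by rewrite gt_eqF//; lra.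
  by rewrite powRM ?powR_ge0// -!powRrM mulVf// powRr1 ?(ltW q0)// mulNr divfK.
apply: (@le_lt_trans _ _ (4 `^ (2 * s) * enorm x `^ (2 * s) * (q * enorm x `^ (- (2 * s))))).
  by rewrite ler_pM ?powR_ge0.
rewrite powRN mulrACA divff ?gt_eqF ?powR_gt0// mulr1 /q.
rewrite mulrC mulrAC divfK ?gt_eqF ?powR_gt0//; lra.
Qed.

Definition dominated_at i l := forall x : 'rV[R]_N, x 0 i < l -> u x <= u (mirror i l x).

(** At a zero of w both sides of the equation vanish, so every one-dimensional
    operator, being nonnegative, vanishes, and w is zero along each coordinate
    line through the point inside the half space. Any two points of the half
    space are joined by changing one coordinate at a time. *)
Lemma strong_maximum i l (x : 'rV[R]_N) : dominated_at i l -> x 0 i < l ->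
  u (mirror i l x) = u x -> forall y, u (mirror i l y) = u y.
Proof.
move=> dom xl ux.
have wge0 (y : 'rV[R]_N) : y 0 i < l -> 0 <= wdiff i l y by move=> yl; rewrite subr_ge0 dom.
have step (y : 'rV[R]_N) j (t : R) : y 0 i < l -> wdiff i l y = 0 ->
    (y + t *: ebasis R j) 0 i < l -> wdiff i l (y + t *: ebasis R j) = 0.
  move=> yl wy yt.
  have ym : half_space_min i l y by split => // z zl; rewrite wy wge0.
  have tw j' := (wline_tame_frac1 i l y j').1.
  have y0 j' : wline i l y j' 0 = 0 by rewrite wline0.
  have d0 : 0 < l - y 0 i by rewrite subr_gt0.
  have ge0 j' : 0 <= frac1 s (wline i l y j').
    have [->|ji] := eqVneq j' i; last first.
      by apply: frac1_min_ge0 => //; exact: half_space_min_line.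
    have := @frac1_antisym_ge R s hs (wline i l y i) _ d0 (tw i) (wline_antisym i l y)
      (half_space_min_linei ym).
    by rewrite y0 oppr0 !mul0r lexx; apply.
  have /eqP : \sum_(j' < N) frac1 s (wline i l y j') = 0.
    have := wdiff_eq i l y.
    have -> : u (mirror i l y) = u y by apply/eqP; rewrite -subr_eq0 -/(wdiff i l y) wy.
    rewrite subrr => /eqP; rewrite mulf_eq0 => /orP[|/eqP//].
    by rewrite gt_eqF// divr_gt0// Cs_gt0.
  rewrite psumr_eq0; last by move=> j' _; exact: ge0.
  move=> /allP/(_ j); rewrite mem_index_enum => /(_ isT) /eqP fj.
  have [ji|ji] := eqVneq j i; last first.
    rewrite -/(wline i l y j t).
    by rewrite (frac1_min_eq0 hs (tw j) (half_space_min_line ym ji) fj) y0.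
  rewrite ji -/(wline i l y i t) in fj *.
  have td : t < l - y 0 i by move: yt; rewrite ji line_coord eqxx mul1r; lra.
  have y0' : wline i l y i 0 <= 0 by rewrite y0.
  exact: (frac1_antisym_eq0 hs d0 (tw i) (wline_antisym i l y) (half_space_min_linei ym) y0' (y0 i) fj td).
have wx : wdiff i l x = 0 by rewrite /wdiff ux subrr.
have half (y : 'rV[R]_N) : y 0 i < l -> wdiff i l y = 0.
  move=> yl.
  pose z (k : nat) : 'rV[R]_N := \row_j (if (j < k)%N then y 0 j else x 0 j).
  have zl k : z k 0 i < l by rewrite mxE; case: ifP.
  have zy : z N = y by apply/rowP => j; rewrite mxE ltn_ord.
  have zw k : (k <= N)%N -> wdiff i l (z k) = 0.
    elim: k => [_|k IH kN].
      by have -> : z 0%N = x by apply/rowP => j; rewrite mxE.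
    pose jk := Ordinal kN.
    have zS : z k.+1 = z k + (y 0 jk - x 0 jk) *: ebasis R jk.
      apply/rowP => j; rewrite line_coord !mxE ltnS leq_eqVlt.
      have [<-|jk'] := eqVneq jk j => /=.
        by rewrite eqxx ltnn /=; ring.
      rewrite mul0r addr0; case: eqVneq => // jk2.
      by case/negP: jk'; apply/eqP/val_inj.
    by rewrite zS; apply: step; [exact: zl|apply: IH; exact: ltnW|rewrite -zS].
  by rewrite -zy zw.
move=> y; have [yl|yl|yl] := ltgtP (y 0 i) l.
- by apply/eqP; rewrite -subr_eq0; apply/eqP/half.
- have ml : (mirror i l y) 0 i < l by rewrite mirror_coord eqxx; lra.
  have := half _ ml; rewrite wdiff_mirror => /eqP; rewrite oppr_eq0 subr_eq0 => /eqP //.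
- by rewrite mirror_fix.
Qed.

(** Two reflections compose to a translation, and u would be periodic. *)
Lemma symmetric_twice i l m : l < m -> (forall x, u (mirror i l x) = u x) ->
  (forall x, u (mirror i m x) = u x) -> False.
Proof.
move=> lm ul um.
have tr (n : nat) : u ((n%:R * (2 * (m - l))) *: ebasis R i) = u 0.
  elim: n => [|n IH]; first by rewrite mul0r scale0r.
  rewrite -IH -[RHS]ul -[RHS]um; congr u; apply/rowP => k.
  rewrite !mirror_coord -natr1; case: eqVneq => [<-|ik].
    by rewrite !mxE !eqxx /=; ring.
  by rewrite !mxE eqxx /= eq_sym (negbTE ik) !mulr0.
have u0 : 0 < u 0 / 2 by rewrite divr_gt0.
have [M M1 HM] := solution_cvg0 u0.
have ml0 : 0 < m - l by rewrite subr_gt0.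
pose n := (Num.truncn (M / (m - l))).+1.
have : u ((n%:R * (2 * (m - l))) *: ebasis R i) <= u 0 / 2.
  apply: HM; rewrite enorm_line ger0_norm; last by rewrite !mulr_ge0// ltW.
  have : M / (m - l) < n%:R by exact: truncnS_gt.
  rewrite ltr_pdivrMr// => H.
  have : 0 <= n%:R * (m - l) by rewrite mulr_ge0// ltW.
  lra.
by rewrite tr; have := hpos 0; lra.
Qed.

Lemma dominated_far i : exists L, forall l, l < L -> dominated_at i l.
Proof.
have [M HM] := negative_minimum_near.
exists (- `|M|) => l lM x xl; rewrite leNgt; apply/negP => ux.
have wx : wdiff i l x < 0 by rewrite subr_lt0.
have [y [yl ymin] wy] := negative_minimum_exists xl wx.
have /(_ wy) := HM i l y (conj yl ymin).
have := coord_le_enorm y i; have := ler_norm M; have := normr_ge0 M.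
have l0 : l < 0 by have := normr_ge0 M; lra.
have y0 : y 0 i < 0 by lra.
rewrite (ltr0_norm y0) (ltr0_norm l0) le_max => *.
lra.
Qed.

(** The plane is the supremum of the positions up to which the comparison holds.
    If u were not symmetric about it, w would be positive on the half space, hence
    by compactness still positive, for slightly larger l, on the region to which
    negative minima are confined. *)
Lemma plane_exists i : exists l0,
  (forall x, u (mirror i l0 x) = u x) /\
  (forall l, l < l0 -> forall x : 'rV[R]_N, x 0 i < l -> u x < u (mirror i l x)).
Proof.
pose A : set R := [set l | forall m, m <= l -> dominated_at i m].
have A0 : A !=set0.
  have [L HL] := dominated_far i; exists (L - 1) => m mL; apply: HL; lra.
have ubA : has_ubound A.
  have u0 : 0 < u 0 / 2 by rewrite divr_gt0.
  have [M M1 HM] := solution_cvg0 u0.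
  exists M => l Al; rewrite leNgt; apply/negP => Ml.
  have l0 : 0 < l by lra.
  have := Al l (lexx l) 0; rewrite mxE => /(_ l0).
  have E : mirror i l 0 = (2 * l) *: ebasis R i.
    apply/rowP => k; rewrite mirror_coord !mxE eqxx /= eq_sym.
    by case: eqVneq => _ /=; ring.
  have : u (mirror i l 0) <= u 0 / 2.
    by apply: HM; rewrite E enorm_line ger0_norm; lra.
  have := hpos 0; lra.
have sA : has_sup A by [].
pose l0 := sup A; exists l0.
have domlt m : m < l0 -> dominated_at i m.
  move=> ml; have [|l Al ll] := @sup_adherent _ A (l0 - m) _ sA; first by rewrite subr_gt0.
  by apply: Al; move: ll; rewrite -/l0; lra.
have dom0 : dominated_at i l0.
  move=> x xl; rewrite leNgt; apply/negP => ux.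
  have c : {for l0, continuous (fun m => u (mirror i m x))}.
    exact: (continuous_comp (@mirror_continuousr R N i x l0) (@solution_continuous _)).
  have near1 : \forall m \near l0, u (mirror i m x) < u x by exact: (cvgr_lt _ c).
  have near2 : \forall m \near l0, x 0 i < m by exact: lt_nbhsr.
  have [m [[m1 m2] ml]] : exists m, (u (mirror i m x) < u x /\ x 0 i < m) /\ m < l0.
    have : \forall m \near l0, u (mirror i m x) < u x /\ x 0 i < m.
      by near=> m; split; near: m.
    move=> /nbhs_ballP[e /= e0 He]; exists (l0 - e / 2); split; last lra.
    by apply: He; rewrite /ball /= ltr_distlC; apply/andP; split; lra.
  by have := domlt m ml x m2; rewrite leNgt m1.
have sym : forall x, u (mirror i l0 x) = u x.
  apply: contrapT => nsym.
  have strict (x : 'rV[R]_N) : x 0 i < l0 -> u x < u (mirror i l0 x).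
    move=> xl; rewrite lt_neqAle dom0// andbT; apply/eqP => ux.
    by apply: nsym; apply: (strong_maximum dom0 xl).
  have [d d0 Hd] := negative_minimum_distance.
  have [M HM] := negative_minimum_near.
  pose M' := Num.max M (`|l0| + 1).
  pose B : set 'rV[R]_N := [set x | x 0 i <= l0 - d / 2].
  have cB : closed B.
    apply: (@closed_comp _ _ (fun x : 'rV[R]_N => x 0 i) [set t | t <= l0 - d / 2]); last exact: closed_le.
    by move=> x _; exact: coord_continuous.
  have cK := @compact_enorm_le R N M' _ cB.
  have cw : continuous (fun z : 'rV[R]_N * R => u (mirror i z.2 z.1) - u z.1).
    have c1 : continuous (fun z : 'rV[R]_N * R => z.1) by move=> ?; exact: cvg_fst.
    move=> z; apply: continuousB.
      exact: (continuous_comp (@mirror_continuous2 R N i z) (@solution_continuous _)).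
    exact: (continuous_comp (c1 z) (@solution_continuous _)).
  have := (compact_near_coveringP _).1 cK R (nbhs l0)
    (fun m x => 0 < u (mirror i m x) - u x) _ => /(_ _ _)[].
    move=> x [_ xB]; have xl : x 0 i < l0 by move: xB; rewrite /B/=; lra.
    have : 0 < u (mirror i l0 x) - u x by rewrite subr_gt0 strict.
    by move=> /(cvgr_gt _ (cw (x, l0))).
  move=> e /= e0 He.
  have e1 : 0 < Num.min (Num.min e (d / 2)) 1 by rewrite !lt_min e0 ltr01 divr_gt0.
  set e' := Num.min _ _ in e1.
  have e'e : e' <= e by rewrite /e' !ge_min lexx.
  have e'd : e' <= d / 2 by rewrite /e' !ge_min lexx orbT.
  have e'1 : e' <= 1 by rewrite /e' ge_min lexx orbT.
  have : A (l0 + e' / 2).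
    move=> m ml; have [ml0|ml0|->//] := ltgtP m l0; first exact: domlt.
    move=> x xl; rewrite leNgt; apply/negP => ux.
    have wx : wdiff i m x < 0 by rewrite subr_lt0.
    have [y ym wy] := negative_minimum_exists xl wx.
    have yd := Hd _ _ _ ym wy; have yM := HM _ _ _ ym wy.
    suff : 0 < wdiff i m y by lra.
    apply: (He m); first by rewrite /ball /= ltr_distlC; apply/andP; split; lra.
    split; last by rewrite /B /=; lra.
    apply: le_trans yM _; rewrite ge_max /M' le_max lexx /= le_max; apply/orP; right.
    have : `|m - l0| <= 1 by rewrite ger0_norm; lra.
    have := ler_normD l0 (m - l0); rewrite (addrC l0) subrK; lra.
  move=> /(ub_le_sup ubA); rewrite -/l0; lra.
split=> // l ll0 x xl; rewrite lt_neqAle domlt// andbT; apply/eqP => ux.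
apply: (symmetric_twice ll0) => //.
exact: (strong_maximum (domlt l ll0) xl (esym ux)).
Unshelve. all: by end_near. Qed.

Lemma symmetric_decreasing : exists xt : 'rV[R]_N,
  forall i : 'I_N, symmetric_about i xt u /\ decreasing_from i xt u.
Proof.
have [xt Hxt] := choice (fun i => plane_exists i).
exists (\row_i xt i) => i; have [sym incr] := Hxt i; split.
  by move=> x; rewrite /reflection mxE; exact: sym.
move=> z; rewrite /hyperplane /= mxE => zi t1 t2 t10 t12.
have flip (t : R) : u (z + t *: ebasis R i) = u (z + (- t) *: ebasis R i).
  by rewrite -[LHS]sym mirror_linei mirror_fix.
pose l := xt i - (t1 + t2) / 2.
have -> : u (z + t1 *: ebasis R i) = u (mirror i l (z + (- t2) *: ebasis R i)).
  rewrite flip; congr u; apply/rowP => k; rewrite mirror_coord !line_coord eqxx mul1r.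
  by case: eqVneq => [<-|_] /=; rewrite ?zi /l; [field|ring].
rewrite flip; apply: incr; first by rewrite /l; lra.
by rewrite line_coord eqxx mul1r zi /l; lra.
Qed.

Section RadialLines.
Variables (xt : 'rV[R]_N) (g : R -> R).
Hypothesis gE : forall x, u x = g (enorm (x - xt)).

Definition line_diff_int (r b : R) : R :=
  \int[lebesgue_measure]_t ((g (r * shift_norm b t) + g (r * shift_norm (- b) t) - 2 * g r) * singular_kernel s t).

Lemma enorm_unit_line (e : 'rV[R]_N) j (r t : R) : \sum_k e 0 k ^+ 2 = 1 -> 0 < r ->
  enorm (r *: e + (r * t) *: ebasis R j) = r * shift_norm (2 * e 0 j) t.
Proof.
move=> e1 r0; set b := 2 * e 0 j.
have -> : r * shift_norm b t = Num.sqrt (r ^+ 2 * (1 + b * t + t ^+ 2)).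
  by rewrite sqrtrM ?sqr_ge0// sqrtr_sqr gtr0_norm.
congr Num.sqrt; rewrite /b.
have -> : \sum_k (r *: e + (r * t) *: ebasis R j) 0 k ^+ 2 =
    \sum_k (r ^+ 2 * e 0 k ^+ 2 + (j == k)%:R * (r ^+ 2 * (2 * e 0 k * t + t ^+ 2))).
  apply: eq_bigr => k _; rewrite line_coord mxE.
  by case: eqVneq => _ /=; ring.
rewrite big_split /= -mulr_sumr e1 (bigD1 j)//= big1 ?addr0; last first.
  by move=> k kj; rewrite eq_sym (negbTE kj) mul0r.
by rewrite eqxx mul1r; ring.
Qed.

(** The substitution t |-> r t along the line brings the point to the unit sphere
    and factors the kernel. *)
Lemma frac1_radial (e : 'rV[R]_N) j (r : R) : \sum_k e 0 k ^+ 2 = 1 -> 0 < r ->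
  lebesgue_measure.-integrable setT (EFin \o
    (fun t => (g (r * shift_norm (2 * e 0 j) t) + g (r * shift_norm (- (2 * e 0 j)) t) - 2 * g r) * singular_kernel s t))
  /\ frac1 s (line (xt + r *: e) j) = r * singular_kernel s r * line_diff_int r (2 * e 0 j).
Proof.
move=> e1 r0; have rn : r != 0 by rewrite gt_eqF.
have k0 : 0 < singular_kernel s r by exact: singular_kernel_gt0.
have le t : line (xt + r *: e) j (r * t) = g (r * shift_norm (2 * e 0 j) t).
  by rewrite /line gE -[xt + _ + _]addrA addrAC subrr add0r enorm_unit_line.
have shift_normN b t : shift_norm b (- t) = shift_norm (- b) t.
  by rewrite /shift_norm mulrN mulNr sqrrN.
have a0 : shift_norm (2 * e 0 j) 0 = 1 by rewrite /shift_norm mulr0 expr0n !addr0 sqrtr1.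
pose G t := (line (xt + r *: e) j t + line (xt + r *: e) j (- t) -
  2 * line (xt + r *: e) j 0) * singular_kernel s t.
have Gi := integrable_frac1 hs (line_tame (xt + r *: e) j).
pose L t := (g (r * shift_norm (2 * e 0 j) t) + g (r * shift_norm (- (2 * e 0 j)) t) - 2 * g r) * singular_kernel s t.
have GL t : G (0 + r * t) = singular_kernel s r * L t.
  rewrite add0r /G -mulrN !le shift_normN.
  have -> : line (xt + r *: e) j 0 = g r by have := le 0; rewrite mulr0 a0 mulr1.
  have -> : singular_kernel s (r * t) = singular_kernel s r * singular_kernel s t.
    by rewrite /singular_kernel normrM powRM// invfM.
  by rewrite /L; ring.
have Gri := integrable_affine 0 rn Gi.
have Li : lebesgue_measure.-integrable setT (EFin \o L).
  have -> : L = (fun t => (singular_kernel s r)^-1 * G (0 + r * t)).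
    by apply/funext => t; rewrite GL mulKf// gt_eqF.
  exact: integrableRZ.
split=> //.
have /(congr1 (fun x => r * x)) := Rintegral_affine 0 rn Gi.
rewrite (gtr0_norm r0) mulrA (mulfV rn) mul1r -/(frac1 s (line (xt + r *: e) j)) => <-.
rewrite -mulrA; congr (_ * _); rewrite -(RintegralZl (singular_kernel s r) measurableT Li).
by apply: eq_Rintegral => t _; exact: GL.
Qed.

(** The points in the directions e_0 and (e_0 + e_1) / sqrt 2 have the same value of
    u. The other directions contribute equally to both. *)
Lemma line_diff_int_balance (r : R) : 0 < r -> line_diff_int r 2 + line_diff_int r 0 = 2 * line_diff_int r (Num.sqrt 2) /\
  forall b, b = 0 \/ b = 2 \/ b = Num.sqrt 2 -> lebesgue_measure.-integrable setT (EFin \o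
    (fun t => (g (r * shift_norm b t) + g (r * shift_norm (- b) t) - 2 * g r) * singular_kernel s t)).
Proof.
move=> r0; pose i0 := Ordinal (ltnW hN); pose i1 := Ordinal hN.
have i10 : i1 != i0 by [].
have r2 : Num.sqrt 2 ^+ 2 = 2 :> R by rewrite sqr_sqrtr.
pose c : R := Num.sqrt 2 / 2.
have c2 : 2 * c = Num.sqrt 2 by rewrite /c; field.
pose e : 'rV[R]_N := ebasis R i0.
pose e' : 'rV[R]_N := c *: ebasis R i0 + c *: ebasis R i1.
have split3 (F : 'I_N -> R) : \sum_k F k = F i0 + (F i1 + \sum_(k | (k != i0) && (k != i1)) F k).
  by rewrite (bigD1 i0)//= (bigD1 i1).
have eE : [/\ e 0 i0 = 1, e 0 i1 = 0 & forall k, (k != i0) && (k != i1) -> e 0 k = 0].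
  rewrite /e !ebasisE eqxx eq_sym (negbTE i10); split=> // k /andP[k0 _].
  by rewrite ebasisE eq_sym (negbTE k0).
have e'E : [/\ e' 0 i0 = c, e' 0 i1 = c & forall k, (k != i0) && (k != i1) -> e' 0 k = 0].
  have e'c k : e' 0 k = c * (i0 == k)%:R + (i1 == k)%:R * c by rewrite line_coord mxE ebasisE.
  have i01 : (i0 == i1) = false by rewrite eq_sym; exact: negbTE.
  rewrite !e'c !eqxx i01 (negbTE i10); split; [by rewrite /=; ring|by rewrite /=; ring|].
  move=> k /andP[k0 k1]; rewrite e'c eq_sym (negbTE k0) eq_sym (negbTE k1) /=.
  by ring.
have [e0 e1 ek] := eE; have [e0' e1' ek'] := e'E.
have eu : \sum_k e 0 k ^+ 2 = 1.
  rewrite split3 e0 e1 big1 ?expr0n ?expr1n ?addr0// => k kk.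
  by rewrite ek// expr0n.
have eu' : \sum_k e' 0 k ^+ 2 = 1.
  rewrite split3 e0' e1' big1 ?addr0; last by move=> k kk; rewrite ek'// expr0n.
  by rewrite /c exprMn r2; field.
have ue : u (xt + r *: e) = u (xt + r *: e').
  have dx y : xt + y - xt = y by rewrite addrAC subrr add0r.
  rewrite !gE !dx; congr g.
  have := enorm_unit_line i0 0 eu r0; have := enorm_unit_line i0 0 eu' r0.
  rewrite !mulr0 !scale0r !addr0 => -> ->.
  by rewrite /shift_norm !mulr0.
have comb (L : R -> R) : \sum_k L (2 * e 0 k) = \sum_k L (2 * e' 0 k) ->
    L 2 + L 0 = 2 * L (Num.sqrt 2).
  rewrite !split3 e0 e1 e0' e1' mulr1 mulr0 c2.
  rewrite (eq_bigr (fun=> L 0)); last by move=> k kk; rewrite ek// mulr0.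
  rewrite [X in _ = _ + (_ + X)](eq_bigr (fun=> L 0)); last first.
    by move=> k kk; rewrite ek'// mulr0.
  lra.
have frac_sum (f : 'rV[R]_N) : \sum_k f 0 k ^+ 2 = 1 -> frac_op s u (xt + r *: f) =
    Cs s / 2 * (r * singular_kernel s r) * \sum_k line_diff_int r (2 * f 0 k).
  move=> f1; rewrite frac_opE -[RHS]mulrA; congr (_ * _); rewrite mulr_sumr.
  by apply: eq_bigr => k _; have [_ ->] := frac1_radial k f1 r0.
have k0 : Cs s / 2 * (r * singular_kernel s r) != 0.
  have h1 := Cs_gt0; have h2 : 0 < singular_kernel s r by rewrite singular_kernel_gt0// gt_eqF.
  have h3 : 0 < Cs s / 2 by rewrite divr_gt0.
  by rewrite gt_eqF// (mulr_gt0 h3)// mulr_gt0.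
split.
  apply: comb; apply: (mulfI k0); rewrite -(frac_sum e eu) -(frac_sum e' eu').
  by apply: oppr_inj; rewrite !heq ue.
move=> b [->|[->|->]].
- by have [+ _] := frac1_radial i1 eu r0; rewrite e1 mulr0.
- by have [+ _] := frac1_radial i0 eu r0; rewrite e0 mulr1.
- by have [+ _] := frac1_radial i0 eu' r0; rewrite e0' c2.
Qed.

End RadialLines.

Lemma not_radially_symmetric (xt : 'rV[R]_N) :
  (forall i : 'I_N, symmetric_about i xt u /\ decreasing_from i xt u) ->
  ~ radially_symmetric xt u.
Proof.
move=> sd [g0 ug0]; pose i0 := Ordinal (ltnW hN).
pose g := line xt i0.
have gabs r : g r = g0 `|r|.
  by rewrite /g /line ug0 addrAC subrr add0r enorm_line.
have gE x : u x = g (enorm (x - xt)).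
  by rewrite gabs ger0_norm ?enorm_ge0.
have geven r : g (- r) = g r by rewrite !gabs normrN.
have [_ dec] := sd i0.
have gdec r : 0 < r -> g r < g 0.
  by move=> r0; apply: dec; rewrite ?lexx.
have [U U0 uU] := solution_bounded.
have [cg [M gM] [C gC]] := line_tame xt i0.
have [f1 tg] := line_taylor xt i0.
pose phi r := g 0 - g r.
have phi_ge0 r : 0 <= phi r.
  rewrite subr_ge0; have [r0|r0|->] := ltgtP r 0.
  - by rewrite -geven ltW// gdec// oppr_gt0.
  - by rewrite ltW// gdec.
  - by [].
have phi_le r : phi r <= (U + `|C|) * Num.min 1 (r ^+ 2).
  have pU : phi r <= U by have := uU (xt + 0 *: ebasis R i0); have := hpos (xt + r *: ebasis R i0); rewrite /phi /g /line; lra.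
  have [r1|r1] := leP `|r| 1.
    rewrite min_r; last by rewrite -(real_normK (num_real r)) expr_le1.
    have := gC r r1; rewrite -/g geven => H.
    have {H} : 2 * phi r <= C * r ^+ 2.
      by apply: le_trans H; rewrite -normrN; apply: le_trans (ler_norm _); rewrite /phi; lra.
    have : C * r ^+ 2 <= `|C| * r ^+ 2 by rewrite ler_wpM2r ?sqr_ge0 ?ler_norm.
    have : 0 <= U * r ^+ 2 by rewrite mulr_ge0 ?sqr_ge0// ltW.
    have := phi_ge0 r; have := mulr_ge0 (normr_ge0 C) (sqr_ge0 r); lra.
  rewrite min_l ?mulr1; last by rewrite -(real_normK (num_real r)) expr_ge1// ltW.
  by have := normr_ge0 C; lra.
have phi_cont : continuous phi.
  move=> r; have c0 : {for r, continuous (fun _ : R => g 0)} by exact: cst_continuous.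
  exact: (continuousB c0 (cg r)).
have phi_taylor : loc_taylor phi.
  exists (fun r => - f1 r) => A; have [K K0 HK] := tg A; exists K => // a b aA bA.
  rewrite /phi (_ : _ - _ = - (g b - g a - f1 a * (b - a))); last by ring.
  by rewrite normrN; exact: HK.
apply: (radial_profile_contradiction hs phi_cont phi_taylor phi_ge0 phi_le).
  by rewrite subr_gt0 gdec.
move=> r r0; have [LE Li] := line_diff_int_balance gE r0.
have JL b : b = 0 \/ b = 2 \/ b = Num.sqrt 2 ->
    diff2_int s b (fun a => phi (r * a)) = line_diff_int g r 0 - line_diff_int g r b.
  move=> hb; have i0' := Li 0 (or_introl erefl); have ib := Li b hb.
  rewrite /line_diff_int -(RintegralB measurableT i0' ib); apply: eq_Rintegral => t _.
  by rewrite /diff2 /phi oppr0; ring.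
rewrite (JL 2) ?(JL (Num.sqrt 2)); [|by right; right|by right; left].
by move: LE; move: (line_diff_int g r 0) (line_diff_int g r 2) (line_diff_int g r _) => x y z; lra.
Qed.

End Solution.

Unset Implicit Arguments.

Theorem theorem1p3 (R : realType) (N : nat) (s p : R) (u : 'rV[R]_N -> R)
  (hN : (2 <= N)%N)
  (hs : 0 < s < 1)
  (hp : N%:R / (N%:R - 2 * s) < p)
  (hC2 : Ck 2 u)
  (hLs : Ls s u)
  (hpos : forall x, 0 < u x)
  (heq : forall x, - frac_op s u x = u x `^ p)
  (hdecay : u =o_ at_infinity
              (fun x => enorm x `^ (- (2 * s / (p - 1))))) :
  exists xt : 'rV[R]_N,
    (forall i : 'I_N, symmetric_about i xt u /\ decreasing_from i xt u) /\
    ~ radially_symmetric xt u.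
Proof.
have [xt sd] := symmetric_decreasing hN hs hp hC2 hpos heq hdecay.
exists xt; split; first exact: sd.
exact: (not_radially_symmetric hN hs hp hC2 hpos heq hdecay sd).
Qed.
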